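(* Let $d\ge2$ and let $G=\mathbf{SO}(d)$ or $G=\mathbf{O}(d)$. If $f$ belongs to a finite-dimensional vector subspace $V\subseteq X_d$ such that $\tau_h(V)\subseteq V$ for all $h\in\mathbb{R}^d$ and $O_P(V)\subseteq V$ for all $P\in G$, then $f$ is an ordinary polynomial in $d$ real variables.
   Context: $X_d$ denotes either $C(\mathbb{R}^d)$ (real-valued continuous functions) or $\mathcal{D}(\mathbb{R}^d)'$ (real-valued Schwartz distributions). For $g\in C(\mathbb{R}^d)$: $\tau_hg(x)=g(x+h)$, $O_Pg(x)=g(Px)$. For $f\in\mathcal{D}(\mathbb{R}^d)'$ and test function $\phi$: $\tau_h(f)\{\phi\}=f\{\phi(\cdot-h)\}$, $O_P(f)\{\phi\}=\frac{1}{|\det P|}f\{\phi(P^{-1}\cdot)\}$. A distribution is an ordinary polynomial if it coincides, as a distribution, with an element of $\mathbb{R}[x_1,\dots,x_d]$. *)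

(* Defs.v *)
From HB Require Import structures.
From mathcomp Require Import all_boot all_order all_algebra.
From mathcomp Require Import all_classical all_reals all_analysis.
From mathcomp Require mpoly.

Set Implicit Arguments.
Unset Strict Implicit.
Unset Printing Implicit Defensive.
Import Order.TTheory GRing.Theory Num.Theory.
Import numFieldNormedType.Exports.
Local Open Scope classical_set_scope.
Local Open Scope ring_scope.

Section Defs.
Variables (R : realType) (d : nat).

Definition pt := 'rV[R]_d.

Definition in_group_Rd (special : bool) (P : 'M[R]_d) : Prop :=
  P *m P^T = 1%:M /\ (special -> \det P = 1).

(* Action of a matrix P on a point: P x (x viewed as a column vector). *)
Definition matact_Rd (P : 'M[R]_d) (x : pt) : pt := x *m P^T.

Definition polyfun_Rd (p : mpoly.mpoly d R) (x : pt) : R :=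
  mpoly.meval (fun i => x 0 i) p.

Definition Cd : set (pt -> R) := [set g | continuous g].
Definition tauC (h : pt) (g : pt -> R) : pt -> R := fun x => g (x + h).
Definition OC (P : 'M[R]_d) (g : pt -> R) : pt -> R := fun x => g (matact_Rd P x).

Definition basis_Rd (i : 'I_d) : pt := delta_mx 0 i.

Fixpoint pder_Rd (s : seq 'I_d) (phi : pt -> R) : pt -> R :=
  match s with
  | [::] => phi
  | i :: s' => 'D_(basis_Rd i) (pder_Rd s' phi)
  end.

Definition smooth_Rd (phi : pt -> R) : Prop :=
  (forall s, continuous (pder_Rd s phi)) /\
  (forall s i x, derivable (pder_Rd s phi) x (basis_Rd i)).

Definition test_fun_Rd (phi : pt -> R) : Prop :=
  smooth_Rd phi /\ exists r : R, forall x : pt, r < `|x| -> phi x = 0.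

(* A real distribution_Rd: a linear functional on test functions, continuous for
   the usual (sequential) convergence in D(R^d); normalised to vanish on
   non-test functions so that equality of distributions is equality. *)
Definition distribution_Rd (T : (pt -> R) -> R) : Prop :=
  [/\ (forall (a : R) phi psi, test_fun_Rd phi -> test_fun_Rd psi ->
         T (fun x => a * phi x + psi x) = a * T phi + T psi),
      (forall u : nat -> pt -> R,
         (forall n, test_fun_Rd (u n)) ->
         (exists r : R, forall n x, r < `|x| -> u n x = 0) ->
         (forall s e, 0 < e -> \forall n \near \oo, forall x, `|pder_Rd s (u n) x| < e) ->
         T (u n) @[n --> \oo] --> 0)
    & (forall phi, ~ test_fun_Rd phi -> T phi = 0)].

Definition Dd : set ((pt -> R) -> R) := [set T | distribution_Rd T].

Definition tauD (h : pt) (T : (pt -> R) -> R) : (pt -> R) -> R :=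
  fun phi => T (fun x => phi (x - h)).
Definition OD (P : 'M[R]_d) (T : (pt -> R) -> R) : (pt -> R) -> R :=
  fun phi => (`|\det P|)^-1 * T (fun x => phi (matact_Rd (invmx P) x)).

(* Lebesgue integral_Rd over R^d, written as an iterated integral_Rd over the
   coordinates (for compactly supported continuous integrands). *)
Definition setcoord_Rd (x : pt) (k : nat) (t : R) : pt :=
  \row_j (if (j : nat) == k then t else x 0 j).

Fixpoint iint_Rd (k : nat) (g : pt -> R) : pt -> R :=
  match k with
  | 0 => g
  | k'.+1 => fun x => Rintegral (@lebesgue_measure R) setT
                         (fun t => iint_Rd k' g (setcoord_Rd x k' t))
  end.

Definition integral_Rd (g : pt -> R) : R := iint_Rd d g 0.

Definition span_of_Rd (X : Type) (n : nat) (g : 'I_n -> X -> R) : set (X -> R) :=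
  [set F | exists c : 'I_n -> R, F = fun x => \sum_(i < n) c i * g i x].

End Defs.

(* Main.v *)
Require Import Defs.
From HB Require Import structures.
From mathcomp Require Import all_boot all_order all_algebra.
From mathcomp Require Import all_classical all_reals all_analysis.
From mathcomp Require Import measurable_realfun complex.
From mathcomp Require Import ring lra.
From mathcomp Require mpoly.
Import Order.TTheory GRing.Theory Num.Theory.
Import numFieldNormedType.Exports.
Import -(notations) mpoly.
Local Open Scope classical_set_scope.
Local Open Scope ring_scope.

(** Write a spanning family of V in a basis dual to finitely many points of the
    underlying set: translation by h then acts by a matrix A(h), and A is a
    continuous homomorphism from R^d to GL_m with A(Ph) similar to A(h) for every
    rotation P. The matrices A(p), for p on a circle, commute and share one
    characteristic polynomial, so after simultaneous triangularization their
    diagonals take finitely many values; two points p <> q of the circle then give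
    a unipotent A(p - q). Rotations of p - q and their sums reach every vector of
    the plane, hence A is unipotent on each coordinate axis, and a continuous
    unipotent one-parameter group is polynomial. So A is polynomial.

    For continuous functions f(h) = (tau_h f)(0) is a combination of entries of A.
    For distributions T = (T_1, ..., T_m), the vector A(-x) T is translation
    invariant, hence a constant multiple of Lebesgue measure, and T = A(x) (A(-x) T).
    A translation-invariant distribution is constant because a test function with
    zero integral along one axis is a derivative along that axis. *)

(** * Commuting similar matrices *)

(** Functions and distributions are handled together by regarding members of V as real functions on
    a set X, namely R^d in one case and the functions on R^d in the other. The entries of A(h) are
    then values of members of V at fixed points, so continuity of A along an axis is continuity of a
    single orbit.

    The obstacle is that similarity of A(Ph) and A(h) constrains only the spectrum as a whole: a
    rotation may permute eigenvalues, and these need not be real. No analysis of characters is made.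
    Having only finitely many possible diagonals forces a coincidence on the circle by the
    pigeonhole principle, and unipotency survives sums because all the A(h) commute. Neither step
    uses continuity, which enters only in passing from rational to real parameters.

    The bound d >= 2 supplies the plane in which to rotate; on the line, the span of exp(x) and
    exp(-x) is invariant under translations and reflection. *)

Lemma char_poly_similar (F : fieldType) (n : nat) (P A B : 'M[F]_n) :
  P \in unitmx -> P *m A = B *m P -> char_poly A = char_poly B.
Proof.
move=> Pu PAB; set Q := map_mx polyC P.
have e : Q *m char_poly_mx A = char_poly_mx B *m Q.
  rewrite /char_poly_mx mulmxBr mulmxBl -!map_mxM PAB; congr (_ - _).
  by rewrite scalar_mxC.
have := congr1 determinant e; rewrite !det_mulmx mulrC => /mulIf; apply.
by rewrite det_map_mx polyC_eq0 -unitfE -unitmxE.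
Qed.

Lemma strict_trig_nilpotent (F : fieldType) (n : nat) (A : 'M[F]_n.+1) :
  is_trig_mx A -> (forall i, A i i = 0) -> A ^+ n.+1 = 0.
Proof.
move=> At A0; have := Cayley_Hamilton A; rewrite char_poly_trig //.
rewrite (eq_bigr (fun=> 'X)) => [|i _]; last by rewrite A0 subr0.
by rewrite prodr_const card_ord rmorphXn /= horner_mx_X.
Qed.

(* A common triangularization turns each [As i] into a diagonal, and there are
   at most [n ^ n] diagonals with entries among the roots of [q]. *)
Lemma commuting_similar_nilpotent (R : rcfType) (n m : nat)
    (As : 'I_m -> 'M[R]_n.+1) (q : {poly R}) :
  (forall i j, As i * As j = As j * As i) ->
  (forall i, char_poly (As i) = q) ->
  (n.+1 ^ n.+1 < m)%N ->
  exists i j, i != j /\ (As i - As j) ^+ n.+1 = 0.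
Proof.
(* Real matrices may lack real eigenvalues, so the triangularization takes place over [R[i]]. *)
move=> AC Aq mn; pose f := real_complex R.
pose Bs i : 'M[R[i]%C]_n.+1 := map_mx f (As i).
have [] := @cotrigonalization _ _ (codom Bs).
  move=> _ _ /codomP[i ->] /codomP[j ->].
  by rewrite /comm_mx /Bs -!map_mxM; congr (map_mx _ _); exact: AC.
move=> P Pu /allP Pt.
have {}Pu : P \in unitmx by exact: unitarymx_unit.
have [T [Tt TE]] : exists T : 'I_m -> 'M[R[i]%C]_n.+1,
    (forall i, is_trig_mx (T i)) /\ (forall i, P *m Bs i = T i *m P).
  exists (fun i => P *m Bs i *m invmx P); split=> i; last by rewrite mulmxKV.
  have := Pt _ (codom_f Bs i).
  by rewrite /similar_to /= conjumx.
have Tq i : char_poly (T i) = map_poly f q.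
  by rewrite -(char_poly_similar _ _ _ _ _ Pu (TE i)) -(Aq i) map_char_poly.
have q0 : map_poly f q != 0.
  have i0 : 'I_m by exists 0%N; apply: leq_trans mn.
  by rewrite -(Tq i0) monic_neq0 // char_poly_monic.
have i0 : 'I_m by exists 0%N; apply: leq_trans mn.
have Tr i x : root (map_poly f q) x = (x \in [tuple T i k k | k < n.+1]).
  rewrite -(Tq i) char_poly_trig // -(big_map (fun k => T i k k) xpredT
    (fun a => 'X - a%:P)) root_prod_XsubC /=.
  apply/mapP/mapP => -[k _ ->]; exists k; rewrite ?mem_index_enum ?mem_enum //.
pose r := [tuple T i0 k k | k < n.+1].
have rP i k : T i k k \in r.
  by rewrite -Tr (Tr i); apply/tnthP; exists k; rewrite tnth_mktuple.
(* [D i] encodes the diagonal of [T i] by positions in [r], the diagonal of [T i0]. With fewer such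
   functions than indices, two indices share a diagonal, and the difference of their triangular
   forms is strictly triangular. *)
pose D i : {ffun 'I_n.+1 -> 'I_n.+1} := [ffun k => inord (index (T i k k) r)].
have DE i k : tnth r (D i k) = T i k k.
  rewrite ffunE (tnth_nth 0) inordK ?nth_index //.
  by have := rP i k; rewrite -index_mem (size_tuple r).
have : ~~ injectiveb D.
  apply/negP => /injectiveP /leq_card.
  by rewrite card_ffun !card_ord leqNgt mn.
move=> /injectivePn[i [j ij Dij]]; exists i, j; split=> //.
have N0 : (T i - T j) ^+ n.+1 = 0.
  apply: strict_trig_nilpotent => [|k]; last by rewrite [LHS]mxE [X in _ + X]mxE -!DE Dij subrr.
  apply/is_trig_mxP => a b ab; rewrite [LHS]mxE [X in _ + X]mxE.
  by move/is_trig_mxP: (Tt i) => ->//; move/is_trig_mxP: (Tt j) => ->//; rewrite subrr.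
have TB : P * (Bs i - Bs j) = (T i - T j) * P.
  by rewrite mulrBr mulrBl -!mulmxE !TE.
have TBk k : P * (Bs i - Bs j) ^+ k = (T i - T j) ^+ k * P.
  elim: k => [|k IH]; first by rewrite !expr0 mulr1 mul1r.
  by rewrite exprSr mulrA IH -mulrA TB mulrA exprSr.
have {}N0 : (Bs i - Bs j) ^+ n.+1 = 0.
  apply: (can_inj (mulKmx Pu)); rewrite mulmx0 /=.
  by have := TBk n.+1; rewrite N0 mul0r.
apply: (@map_mx_inj _ _ f); rewrite raddf0 -N0.
by rewrite rmorphXn /= raddfB.
Qed.

(** * Plane rotations *)

(** The minimal polynomial divides a power of X, so it is itself a power of X up to a unit, and its
    degree is at most that of the characteristic polynomial. This allows unipotency to be expressed
    with the single exponent [n.+1]. *)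
Lemma nilpotent_index (F : fieldType) (n m : nat) (N : 'M[F]_n.+1) :
  N ^+ m = 0 -> N ^+ n.+1 = 0.
Proof.
move=> Nm; have /dvdp_exp_XsubCP[k _ kE] : mxminpoly N %| ('X - 0%:P) ^+ m.
  by apply: mxminpoly_min; rewrite subr0 rmorphXn /= horner_mx_X.
have kn : (k <= n.+1)%N.
  have := dvdp_leq (monic_neq0 (char_poly_monic N)) (mxminpoly_dvd_char N).
  by rewrite size_char_poly (eqp_size kE) subr0 size_polyXn.
have : horner_mx N (('X - 0%:P) ^+ k) = 0.
  apply/mxminpoly_minP; by rewrite (eqp_dvdl _ kE).
rewrite subr0 rmorphXn /= horner_mx_X => Nk.
have -> : N ^+ n.+1 = N ^+ (n.+1 - k) * N ^+ k by rewrite -exprD subnK.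
by rewrite Nk mulr0.
Qed.

Section Rotation.
Variables (R : rcfType) (d : nat) (i k : 'I_d).
Hypothesis ik : i != k.

Let E : 'M[R]_d := delta_mx i i + delta_mx k k.
Let J : 'M[R]_d := delta_mx i k - delta_mx k i.

(** [E] is the projection onto the plane of the axes [i] and [k], and [J] a quarter turn of that
    plane. Cosine and sine are free parameters, constrained by [c ^+ 2 + s ^+ 2 = 1] where needed,
    so no angle appears. *)
Definition rotmx (c s : R) : 'M[R]_d := 1%:M + (c - 1) *: E + s *: J.

Let ki : (k == i) = false. Proof. by rewrite eq_sym (negbTE ik). Qed.

Let dE := (mulmxDl, mulmxDr, mulNmx, mulmxN, mul_delta_mx_cond, eqxx,
  negbTE ik, ki, mulr0n, mulr1n, @oppr0, @addr0, @add0r, @opprK).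

(** On the plane [E] acts as 1 and [J] as a square root of -1, whence the formula for complex
    multiplication; off the plane both factors are the identity. *)
Lemma rotmxM c s c' s' :
  rotmx c s *m rotmx c' s' = rotmx (c * c' - s * s') (c * s' + s * c').
Proof.
have EE : E *m E = E by rewrite /E !dE.
have EJ : E *m J = J by rewrite /E /J !dE.
have JE : J *m E = J by rewrite /E /J !dE addrC.
have JJ : J *m J = - E by rewrite /E /J !dE opprD.
rewrite /rotmx !(mulmxDl, mulmxDr) -!(scalemxAl, scalemxAr) EE EJ JE JJ.
rewrite !(mul1mx, mulmx1).
by apply/matrixP => a b; rewrite !mxE; ring.
Qed.

Lemma rotmx1 : rotmx 1 0 = 1%:M.
Proof. by rewrite /rotmx subrr !scale0r !addr0. Qed.

Lemma tr_rotmx c s : (rotmx c s)^T = rotmx c (- s).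
Proof.
apply/matrixP => a b; rewrite !mxE eq_sym ![(b == _) && _]andbC; ring.
Qed.

Lemma rotmx_orthogonal c s : c ^+ 2 + s ^+ 2 = 1 ->
  rotmx c s *m (rotmx c s)^T = 1%:M.
Proof.
move=> cs; rewrite tr_rotmx rotmxM -rotmx1; congr rotmx; last by ring.
by rewrite -cs; ring.
Qed.

(* Every plane rotation is the square of the rotation by half the angle. *)
Lemma det_rotmx c s : c ^+ 2 + s ^+ 2 = 1 -> \det (rotmx c s) = 1.
Proof.
move=> cs; suff [c' [s' [cs' -> ->]]] : exists c' s' : R,
    [/\ c' ^+ 2 + s' ^+ 2 = 1, c = c' * c' - s' * s' & s = c' * s' + s' * c'].
  rewrite -rotmxM det_mulmx.
  by have := congr1 determinant (rotmx_orthogonal _ _ cs'); rewrite det_mulmx det_tr det1.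
(* The half-angle formulas divide by the cosine of the half angle, which vanishes exactly for the
   half turn; that one is the square of a quarter turn. *)
have [c1|c1] := eqVneq c (- 1).
  have s0 : s = 0.
    by apply/eqP; rewrite -sqrf_eq0; apply/eqP; move: cs; rewrite c1; lra.
  by exists 0, 1; rewrite c1 s0; split; ring.
have c1' : 0 < (1 + c) / 2.
  have : 0 <= s ^+ 2 := sqr_ge0 s.
  have [h|h] : c < -1 \/ -1 < c by (move: c1; rewrite neq_lt => /orP[]; auto).
    nra.
  lra.
have r2 := sqr_sqrtr (ltW c1').
have r0 : Num.sqrt ((1 + c) / 2) != 0 by rewrite gt_eqF // sqrtr_gt0.
exists (Num.sqrt ((1 + c) / 2)), (s / (2 * Num.sqrt ((1 + c) / 2))).
move: (Num.sqrt _) r2 r0 => r r2 r0.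
have cE : c = 2 * r ^+ 2 - 1 by rewrite r2; field.
have sE : s ^+ 2 = 4 * r ^+ 2 * (1 - r ^+ 2).
  have -> : s ^+ 2 = 1 - c ^+ 2 by rewrite -cs addrC addKr.
  by rewrite cE; ring.
have e : (s / (2 * r)) ^+ 2 = 1 - r ^+ 2.
  by rewrite expr_div_n sE; field.
split; [by rewrite e addrC subrK | by rewrite -!expr2 e cE; ring | by field].
Qed.

Lemma delta_rotmx_l c s :
  delta_mx 0 i *m rotmx c s = c *: delta_mx 0 i + s *: delta_mx 0 k :> 'rV[R]_d.
Proof.
rewrite /rotmx /E /J !mulmxDr -!scalemxAr !dE mulmx1.
by apply/matrixP => a b; rewrite !mxE; ring.
Qed.

Lemma delta_rotmx_r c s :
  delta_mx 0 k *m rotmx c s = c *: delta_mx 0 k - s *: delta_mx 0 i :> 'rV[R]_d.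
Proof.
rewrite /rotmx /E /J !mulmxDr -!scalemxAr !dE mulmx1.
by apply/matrixP => a b; rewrite !mxE; ring.
Qed.

End Rotation.

(** * Homomorphisms intertwined by rotations *)

Section RotationInvariantHom.
Variables (R : realType) (d n : nat) (A : 'rV[R]_d -> 'M[R]_n.+1).
Hypothesis d2 : (2 <= d)%N.
Hypothesis AD : forall x y, A (x + y) = A x * A y.
Hypothesis A0 : A 0 = 1.
Hypothesis AP : forall P : 'M[R]_d, P *m P^T = 1%:M -> \det P = 1 ->
  exists2 C : 'M[R]_n.+1, C \in unitmx & forall x, C * A x = A (x *m P^T) * C.

Let unip x := (A x - 1) ^+ n.+1 = 0.

Let AC x y : GRing.comm (A x) (A y).
Proof. by rewrite /GRing.comm -!AD addrC. Qed.

(** [A (x + y) - 1] is a sum of two commuting nilpotents. In its power of exponent [n.+1 + n.+1]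
    every binomial term contains one of them at least [n.+1] times, and [nilpotent_index] lowers the
    exponent again. *)
Let unipD x y : unip x -> unip y -> unip (x + y).
Proof.
move=> ux uy; apply: (nilpotent_index _ _ (n.+1 + n.+1)).
have -> : A (x + y) - 1 = (A x - 1) * A y + (A y - 1).
  by rewrite AD mulrBl mul1r addrA subrK.
have c1 : GRing.comm (A x - 1) (A y).
  by apply: commr_sym; apply: commrB; [exact: AC | exact: commr1].
have c2 : GRing.comm ((A x - 1) * A y) (A y - 1).
  apply: commrB; last exact: commr1.
  by apply: commr_sym; apply: commrM; [exact: commr_sym | ].
rewrite exprDn_comm // big1 // => j _.
have [jn|jn] := leqP n.+1 j.
  by rewrite -(subnK jn) exprD uy mulr0 mulr0 mul0rn.
have nj : (n.+1 <= n.+1 + n.+1 - j)%N by rewrite -addnBA ?leq_addr // ltnW.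
by rewrite -(subnK nj) exprMn_comm // exprD ux mulr0 !mul0r mul0rn.
Qed.

Let unipP (P : 'M[R]_d) x : P *m P^T = 1%:M -> \det P = 1 -> unip x -> unip (x *m P^T).
Proof.
move=> PP P1 ux; have [C Cu CA] := AP P PP P1.
have e k : C * (A x - 1) ^+ k = (A (x *m P^T) - 1) ^+ k * C.
  elim: k => [|k IH]; first by rewrite !expr0 mulr1 mul1r.
  rewrite exprSr mulrA IH -mulrA mulrBr CA mulr1.
  by rewrite -{2}[C]mul1r -mulrBl mulrA -exprSr.
have := e n.+1; rewrite ux mulr0 => /esym h; rewrite /unip.
by apply: (can_inj (mulmxK Cu)); rewrite mul0mx.
Qed.

Section Plane.
Variables i k : 'I_d.
Hypothesis ik : i != k.
Let vec (a b : R) : 'rV[R]_d := a *: delta_mx 0 i + b *: delta_mx 0 k.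

Let vec_rot a b c s : vec a b *m rotmx R d i k c s = vec (a * c - b * s) (a * s + b * c).
Proof.
rewrite /vec mulmxDl -!scalemxAl delta_rotmx_l // delta_rotmx_r //.
by apply/matrixP => x y; rewrite !mxE; ring.
Qed.

Let unip_rot a b c s : c ^+ 2 + s ^+ 2 = 1 -> unip (vec a b) ->
  unip (vec (a * c - b * s) (a * s + b * c)).
Proof.
move=> cs u; rewrite -vec_rot.
(* A matrix acts on row vectors through its transpose, so the rotation supplied is the one by the
   opposite angle. *)
have cs' : c ^+ 2 + (- s) ^+ 2 = 1 by rewrite sqrrN.
have := unipP _ _ (rotmx_orthogonal _ _ _ _ ik _ _ cs') (det_rotmx _ _ _ _ ik _ _ cs') u.
by rewrite tr_rotmx opprK.
Qed.

Let unipMn x m : unip x -> unip (x *+ m).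
Proof.
move=> ux; elim: m => [|m IH]; last by rewrite mulrS; exact: unipD.
by rewrite mulr0n /unip A0 subrr expr0n.
Qed.

Let vecZ t a b : t *: vec a b = vec (t * a) (t * b).
Proof. by rewrite /vec scalerDr !scalerA. Qed.

(* The two rotations of [v] by opposite angles add up to [2 cos th * v]. *)
Let unipZ a b t : `|t| <= 2 -> unip (vec a b) -> unip (vec (t * a) (t * b)).
Proof.
move=> t2 u; set c := t / 2; set s := Num.sqrt (1 - c ^+ 2).
have cs : c ^+ 2 + s ^+ 2 = 1.
  rewrite sqr_sqrtr ?subr_ge0; first by rewrite addrC subrK.
  rewrite -real_normK ?num_real // exprn_ile1 // /c normf_div.
  by rewrite [`|2|]ger0_norm // ler_pdivrMr // mul1r.
have cs' : c ^+ 2 + (- s) ^+ 2 = 1 by rewrite sqrrN.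
have := unipD _ _ (unip_rot _ _ _ _ cs u) (unip_rot _ _ _ _ cs' u).
rewrite /vec addrACA -!scalerDl.
suff [-> ->] : a * c - b * s + (a * c - b * - s) = t * a /\
   a * s + b * c + (a * - s + b * c) = t * b by [].
by rewrite /c; split; field.
Qed.

(** Write t as a natural number m times t / m with [|t / m| <= 2]: the small factor comes from
    [unipZ], the multiple from sums. *)
Let unip_line a b t : unip (vec a b) -> unip (vec (t * a) (t * b)).
Proof.
move=> u; set m := (Num.trunc `|t|).+1.
have m0 : (m%:R : R) != 0 by rewrite pnatr_eq0.
have tm : `|t / m%:R| <= 2.
  rewrite normf_div [`|m%:R|]ger0_norm // ler_pdivrMr ?ltr0n //.
  by apply: (le_trans (ltW (truncnS_gt _))); rewrite ler_peMl // ler1n.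
have -> : vec (t * a) (t * b) = vec (t / m%:R * a) (t / m%:R * b) *+ m.
  by rewrite -!vecZ -[RHS]scaler_nat scalerA mulrC divfK.
by apply: unipMn; exact: unipZ.
Qed.

Lemma unipotent_on_plane_axis t : unip (t *: delta_mx 0 i).
Proof.
(* One point more than there are diagonals. The points lie on the unit circle and have distinct
   abscissas 1, 1/2, 1/3, ..., so differences of two of them are nonzero. *)
pose m := (n.+1 ^ n.+1).+1.
pose c (a : 'I_m) : R := a.+1%:R^-1; pose s a := Num.sqrt (1 - c a ^+ 2).
have c0 a : 0 < c a by rewrite invr_gt0 ltr0n.
have cs a : c a ^+ 2 + s a ^+ 2 = 1.
  rewrite sqr_sqrtr ?subr_ge0; first by rewrite addrC subrK.
  by apply: exprn_ile1; [exact: ltW | rewrite /c invf_le1 ?ler1n ?ltr0n].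
have [| | |a [b [ab]]] := commuting_similar_nilpotent R n m (fun a => A (vec (c a) (s a)))
  (char_poly (A (vec 1 0))).
- by move=> a b; exact: AC.
(* Each point is a rotation of [vec 1 0], so its matrix is similar to [A (vec 1 0)]. *)
- move=> a; have cs' : c a ^+ 2 + (- s a) ^+ 2 = 1 by rewrite sqrrN.
  have [C Cu CA] := AP _ (rotmx_orthogonal _ _ _ _ ik _ _ cs') (det_rotmx _ _ _ _ ik _ _ cs').
  apply/esym/(char_poly_similar _ _ _ _ _ Cu).
  have := CA (vec 1 0); rewrite tr_rotmx // opprK vec_rot !mul1r !mul0r subr0 addr0.
  by rewrite -mulmxE.
- rewrite /m; exact: ltnSn.
move=> N0; set x := c a - c b; set y := s a - s b.
have uxy : unip (vec x y).
  have -> : vec x y = vec (c a) (s a) - vec (c b) (s b).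
    by rewrite /vec !scalerBl opprD addrACA.
  rewrite /unip AD.
  have -> : A (vec (c a) (s a)) * A (- vec (c b) (s b)) - 1 =
     (A (vec (c a) (s a)) - A (vec (c b) (s b))) * A (- vec (c b) (s b)).
    by rewrite mulrBl -[X in _ = _ - X]AD subrr A0.
  rewrite exprMn_comm ?N0 ?mul0r //.
  by apply: commr_sym; apply: commrB; exact: AC.
have x0 : x != 0.
  by rewrite subr_eq0 (inj_eq invr_inj) eqr_nat eqSS (inj_eq val_inj).
have r2 : 0 < x ^+ 2 + y ^+ 2.
  by rewrite ltr_wpDr ?sqr_ge0 // lt_def sqr_ge0 sqrf_eq0 x0.
set r := Num.sqrt (x ^+ 2 + y ^+ 2).
have r0 : r != 0 by rewrite gt_eqF // sqrtr_gt0.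
have rr : r ^+ 2 = x ^+ 2 + y ^+ 2 by rewrite sqr_sqrtr // ltW.
(* The rotation with this cosine and sine takes (x, y) to (r, 0); applied to (x, y) scaled by t / r
   it yields (t, 0). *)
have e : (x / r) ^+ 2 + (- y / r) ^+ 2 = 1.
  by rewrite !expr_div_n sqrrN -mulrDl -rr divff // sqrf_eq0.
have := unip_rot _ _ _ _ e (unip_line _ _ (t / r) uxy).
congr (unip (_)); rewrite /vec.
rewrite (_ : t / r * x * (- y / r) + t / r * y * (x / r) = 0) ?scale0r ?addr0; last by field.
congr (_ *: _).
have -> : t / r * x * (x / r) - t / r * y * (- y / r) = t * (x ^+ 2 + y ^+ 2) / r ^+ 2.
  by field.
by rewrite -rr mulfK // sqrf_eq0.
Qed.
End Plane.

Lemma unipotent_on_axes i t : (A (t *: delta_mx 0 i) - 1) ^+ n.+1 = 0.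
Proof.
have [k ik] : exists k : 'I_d, i != k.
  have [i0|i0] := eqVneq (i : nat) 0%N.
    (* [d2] reads as [1 < d], so this is the axis of index 1; the next line takes the axis of index
       0. *)
    by exists (Ordinal d2); rewrite -val_eqE /= i0.
  by exists (Ordinal (ltnW d2)); rewrite -val_eqE /=.
exact: unipotent_on_plane_axis ik t.
Qed.
End RotationInvariantHom.

(** * Unipotent one-parameter groups *)

Lemma poly_eq_on_nat (R : numDomainType) (p q : {poly R}) :
  (forall k : nat, p.[k%:R] = q.[k%:R]) -> p = q.
Proof.
move=> pq; apply/eqP; rewrite -subr_eq0; apply/eqP.
pose rs : seq R := [seq k%:R | k <- iota 0 (size (p - q))].
apply: (@roots_geq_poly_eq0 _ _ rs).
- by apply/allP => _ /mapP[k _ ->]; rewrite rootE hornerD hornerN pq subrr.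
- rewrite map_inj_uniq ?iota_uniq // => a b /eqP.
  by rewrite eqr_nat => /eqP.
- by rewrite size_map size_iota.
Qed.

Definition binomial_poly (R : fieldType) (j : nat) : {poly R} :=
  (j`!%:R)^-1 *: \prod_(i < j) ('X - i%:R%:P).

Lemma binomial_polyE (R : numFieldType) (j k : nat) :
  (binomial_poly R j).[k%:R] = 'C(k, j)%:R.
Proof.
rewrite /binomial_poly hornerZ horner_prod.
have f0 : (j`!%:R : R) != 0 by rewrite pnatr_eq0 -lt0n fact_gt0.
apply: (mulfI f0); rewrite mulVKf // -natrM mulnC bin_ffact.
elim: j {f0} => [|j IH]; first by rewrite big_ord0.
rewrite big_ord_recr /= IH ffactnSr natrM !hornerE.
have [jk|kj] := leqP j k; first by rewrite natrB.
by rewrite ffact_small // !mul0r.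
Qed.

(** The point is that the number of terms does not depend on [k]: powers of a unipotent element are
    polynomial in the exponent. Both truncations are compared with the sum over [k.+1 + n] terms. *)
Lemma nilpotent_binomial (R : nzRingType) (N : R) (n k : nat) :
  N ^+ n = 0 -> (N + 1) ^+ k = \sum_(j < n) N ^+ j *+ 'C(k, j).
Proof.
move=> Nn; have trunc (F : nat -> R) (a m : nat) : (forall j, (a <= j)%N -> F j = 0) ->
    (a <= m)%N -> \sum_(j < m) F j = \sum_(j < a) F j.
  move=> F0 am; rewrite (big_ord_widen _ _ am) [RHS]big_mkcond /=.
  by apply: eq_bigr => j _; case: ltnP => // /F0.
rewrite exprD1n -(trunc (fun j => N ^+ j *+ 'C(k, j)) _ (k.+1 + n)%N) ?leq_addr //.
  apply: (trunc (fun j => N ^+ j *+ 'C(k, j))); last exact: leq_addl.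
  by move=> j nj; rewrite -(subnK nj) exprD Nn mulr0 mul0rn.
by move=> j kj; rewrite bin_small // mulr0n.
Qed.

Section UnipotentFlow.
Variables (R : realType) (n : nat) (U : R -> 'M[R]_n.+1).
Hypothesis UD : forall s t, U (s + t) = U s * U t.
Hypothesis U0 : U 0 = 1.
Hypothesis Unil : forall t, (U t - 1) ^+ n.+1 = 0.
Hypothesis Ucont : forall a b, continuous (fun t => U t a b).

Let ev (p : 'M[{poly R}]_n.+1) t : 'M[R]_n.+1 := \matrix_(a, b) (p a b).[t].

Let lattice_poly h : exists p, forall k : nat, U (k%:R * h) = ev p k%:R.
Proof.
exists (\matrix_(a, b) \sum_(j < n.+1) ((U h - 1) ^+ j) a b *: binomial_poly R j) => k.
have -> : U (k%:R * h) = (U h - 1 + 1) ^+ k.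
  rewrite subrK; elim: k => [|k IH]; first by rewrite mul0r U0 expr0.
  by rewrite -natr1 mulrDl mul1r UD IH exprSr.
rewrite (nilpotent_binomial _ _ _ _ (Unil h)); apply/matrixP => a b.
rewrite !mxE summxE horner_sum; apply: eq_bigr => j _.
by rewrite hornerZ binomial_polyE mulmxnE mulr_natr.
Qed.

(** The polynomials found for the steps 1 and 1/(q+1) agree, after rescaling, at all natural
    numbers, hence identically. So one polynomial matrix gives U on nonnegative rationals, then on
    nonnegative reals by continuity, then on all reals by the group law. *)
Lemma unipotent_flow_poly : exists p : 'M[{poly R}]_n.+1, forall t, U t = \matrix_(a, b) (p a b).[t].
Proof.
have [p pE] := lattice_poly 1; exists p; rewrite -/(ev p _).
have Unat k : U k%:R = ev p k%:R by rewrite -pE mulr1.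
have Uq k q : U (k%:R / q.+1%:R) = ev p (k%:R / q.+1%:R).
  have q0 : (q.+1%:R : R) != 0 by rewrite pnatr_eq0.
  have [p' p'E] := lattice_poly (q.+1%:R^-1).
  rewrite p'E; apply/matrixP => a b; rewrite !mxE.
  suff -> : p a b = p' a b \Po (q.+1%:R *: 'X).
    by rewrite horner_comp hornerZ hornerX mulrC divfK.
  apply: poly_eq_on_nat => m; have := Unat m.
  have -> : (m%:R : R) = (m * q.+1)%:R * q.+1%:R^-1 by rewrite natrM mulfK.
  rewrite p'E => /matrixP/(_ a b); rewrite !mxE => <-.
  by rewrite horner_comp hornerZ hornerX natrM mulfK // mulrC.
have Upos t : 0 <= t -> U t = ev p t.
  rewrite le_eqVlt => /predU1P[<-|t0]; first exact: (Unat 0%N).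
  apply/matrixP => a b; rewrite mxE; apply/eqP; apply/negPn/negP => neq.
  pose w s := U s a b - (p a b).[s].
  have wc : continuous w.
    by move=> s; apply: cvgB; [exact: Ucont | exact: continuous_horner].
  have w0 : w t != 0 by rewrite subr_eq0.
  (* If [w t] were nonzero, [w] would be nonzero near [t], in particular at some positive rational,
     which contradicts [Uq]. *)
  have : \forall s \near t, w s != 0.
    have := wc t; move/(_ [set x | x != 0]); apply.
    by apply: open_nbhs_nbhs; split; [exact: open_neq | exact: w0].
  case/nbhs_ballP => e /= e0 he.
  have [|r] := @rat_in_itvoo R (Num.max 0 (t - e)) (t + e).
    by rewrite gt_max; apply/andP; split; lra.
  rewrite in_itv /= gt_max => /andP[/andP[r0 rl] ru].
  have : w (ratr r) != 0 by apply: he; rewrite /ball /= ltr_distl; apply/andP; split; lra.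
  have [k [q ->]] : exists k q : nat, ratr r = k%:R / q.+1%:R :> R.
    move: r0; rewrite ltr0q -numq_gt0 /ratr.
    case: (numq r) => // k _; have := denq_gt0 r; case: (denq r) => // -[//|q] _.
    by exists k, q.
  by move=> /eqP; apply; rewrite /w Uq mxE subrr.
move=> t; have [t0|t0] := leP 0 t; first exact: Upos.
pose m := (Num.trunc `|t|).+1.
have tm : 0 <= t + m%:R.
  have := truncnS_gt `|t|; rewrite -/m => h; have := ler_norm (- t); rewrite normrN; lra.
have Ut : U t = U (- m%:R) * ev p (t + m%:R) by rewrite -Upos // -UD addrC addrK.
rewrite Ut; apply/matrixP => a b; rewrite !mxE.
(* Comparing both sides at natural numbers gives the group law for the shift by m as an identity of
   polynomials, which then applies to negative t. *)
have -> : p a b = \sum_l (U (- m%:R) a l) *: (p l b \Po ('X + m%:R%:P)).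
  apply: poly_eq_on_nat => k; have := Unat k.
  have -> : U k%:R = U (- m%:R) * ev p (k%:R + m%:R).
    by rewrite -Upos ?addr_ge0 ?ler0n // -UD addrC addrK.
  move=> /matrixP/(_ a b); rewrite !mxE => <-.
  rewrite horner_sum; apply: eq_bigr => l _.
  by rewrite !mxE !hornerE horner_comp !hornerE.
rewrite horner_sum; apply: eq_bigr => l _.
by rewrite !mxE !hornerE horner_comp !hornerE.
Qed.
End UnipotentFlow.

(** * Polynomial functions *)

Section PolynomialFunctions.
Variables (R : realType) (d : nat).

Definition polynomial_fun (F : pt R d -> R) : Prop :=
  exists p : mpoly.mpoly d R, forall x, F x = polyfun_Rd p x.

Lemma polynomial_fun_const (c : R) : polynomial_fun (fun=> c).
Proof. by exists (mpoly.mpolyC d c) => x; rewrite /polyfun_Rd mpoly.mevalC. Qed.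

Lemma polynomial_fun_coord (i : 'I_d) : polynomial_fun (fun x => x 0 i).
Proof. by exists (mpoly.mpolyX R (mpoly.mnm1 i)) => x; rewrite /polyfun_Rd mpoly.mevalXU. Qed.

Lemma polynomial_funD F G : polynomial_fun F -> polynomial_fun G ->
  polynomial_fun (fun x => F x + G x).
Proof.
by move=> [p pE] [q qE]; exists (p + q) => x; rewrite pE qE /polyfun_Rd mpoly.mevalD.
Qed.

Lemma polynomial_funM F G : polynomial_fun F -> polynomial_fun G ->
  polynomial_fun (fun x => F x * G x).
Proof.
by move=> [p pE] [q qE]; exists (p * q) => x; rewrite pE qE /polyfun_Rd mpoly.mevalM.
Qed.

Lemma polynomial_fun_ext F G : F =1 G -> polynomial_fun F -> polynomial_fun G.
Proof. by move=> FG [p pE]; exists p => x; rewrite -FG. Qed.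

Lemma polynomial_fun_sum (I : Type) (r : seq I) (P : pred I) (F : I -> pt R d -> R) :
  (forall i, polynomial_fun (F i)) -> polynomial_fun (fun x => \sum_(i <- r | P i) F i x).
Proof.
move=> FP; elim: r => [|i r IH].
  by apply: polynomial_fun_ext (polynomial_fun_const 0) => x; rewrite big_nil.
have := polynomial_funD _ _ (FP i) IH; case Pi : (P i) => H.
  by apply: polynomial_fun_ext H => x; rewrite big_cons Pi.
by apply: polynomial_fun_ext IH => x; rewrite big_cons Pi.
Qed.

Lemma polynomial_fun_horner (p : {poly R}) (i : 'I_d) :
  polynomial_fun (fun x => p.[x 0 i]).
Proof.
elim/poly_ind: p => [|p c IH].
  by apply: polynomial_fun_ext (polynomial_fun_const 0) => x; rewrite horner0.
have := polynomial_funD _ _ (polynomial_funM _ _ IH (polynomial_fun_coord i))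
  (polynomial_fun_const c).
by apply: polynomial_fun_ext => x; rewrite !hornerE.
Qed.

(** A vector is the sum of its components along the axes, so A is the product of its restrictions to
    the axes, each polynomial in one coordinate. *)
Lemma rotation_invariant_hom_polynomial (n : nat) (A : pt R d -> 'M[R]_n) :
  (2 <= d)%N ->
  (forall x y, A (x + y) = A x *m A y) -> A 0 = 1%:M ->
  (forall P : 'M[R]_d, P *m P^T = 1%:M -> \det P = 1 ->
     exists2 C : 'M[R]_n, C \in unitmx & forall x, C *m A x = A (matact_Rd P x) *m C) ->
  (forall i a b, continuous (fun t : R => A (t *: basis_Rd R i) a b)) ->
  forall a b, polynomial_fun (fun x => A x a b).
Proof.
move=> d2 AD A0 AP Ac; case: n => [|n] in A AD A0 AP Ac *; first by case.
have /choice[p pE] i : exists p : 'M[{poly R}]_n.+1,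
    forall t, A (t *: basis_Rd R i) = \matrix_(a, b) (p a b).[t].
  apply: unipotent_flow_poly => [s t||t|a b].
  - by rewrite scalerDl AD.
  - by rewrite scale0r A0.
  - exact: unipotent_on_axes.
  - exact: Ac.
pose S (r : seq 'I_d) (x : pt R d) := \sum_(i <- r) x 0 i *: basis_Rd R i.
have AS r a b : polynomial_fun (fun x => A (S r x) a b).
  elim: r a b => [|i r IH] a b.
    apply: polynomial_fun_ext (polynomial_fun_const ((1%:M : 'M[R]_n.+1) a b)) => x.
    by rewrite /S big_nil A0.
  apply: (polynomial_fun_ext (fun x => \sum_l (p i a l).[x 0 i] * A (S r x) l b)).
    by move=> x; rewrite /S big_cons AD pE !mxE; apply: eq_bigr => l _; rewrite !mxE.
  apply: polynomial_fun_sum => l.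
  by apply: polynomial_funM; [exact: polynomial_fun_horner | exact: IH].
move=> a b; apply: polynomial_fun_ext (AS (index_enum 'I_d) a b) => x.
by rewrite /S /basis_Rd -row_sum_delta.
Qed.

End PolynomialFunctions.

(** * Invariant finite-dimensional spaces *)

(** Gaussian elimination with evaluation points as pivots: the coordinates of a member of the span
    are its values at the points [x j]. By induction the last generator either is interpolated by
    the points at hand or provides a new one. *)
Lemma span_dual_basis (R : realType) (X : Type) (n : nat) (g : 'I_n -> X -> R) :
  exists (m : nat) (e : 'I_m -> X -> R) (x : 'I_m -> X),
  [/\ forall i j, e i (x j) = (i == j)%:R,
      forall i, span_of_Rd g (e i)
    & forall F, span_of_Rd g F -> forall y, F y = \sum_j F (x j) * e j y].
Proof.
elim: n g => [|n IH] g.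
  exists 0%N, (fun=> fun=> 0), (fun i : 'I_0 => False_rect X (notF (ltn_ord i))).
  split=> [[]//|[]//|F [c ->] y]; by rewrite !big_ord0.
have [m [e [x [ex eV eE]]]] := IH (fun i => g (widen_ord (leqnSn n) i)).
(* [r] is the error in interpolating the last generator at the old points. *)
pose u := g ord_max; pose r y := u y - \sum_j u (x j) * e j y.
have spanS F : span_of_Rd (fun i => g (widen_ord (leqnSn n) i)) F -> forall c,
    span_of_Rd g (fun y => F y + c * u y).
  move=> [a ->] c; exists (fun i => if insub (i : nat) is Some j then a j else c).
  apply/funext => y; rewrite big_ord_recr /=; congr (_ + _ * _).
    by apply: eq_bigr => i _; rewrite valK.
  by rewrite insubF //= ltnn.
have spanI F : span_of_Rd g F -> exists c F0,
    span_of_Rd (fun i => g (widen_ord (leqnSn n) i)) F0 /\ forall y, F y = F0 y + c * u y.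
  move=> [a ->]; exists (a ord_max), (fun y => \sum_i a (widen_ord (leqnSn n) i) *
    g (widen_ord (leqnSn n) i) y); split; first by exists (fun i => a (widen_ord (leqnSn n) i)).
  by move=> y; rewrite big_ord_recr.
have eS i : span_of_Rd g (e i).
  by have := spanS _ (eV i) 0; congr span_of_Rd; apply/funext => y; rewrite mul0r addr0.
have [r0|] := pselect (forall y, r y = 0).
  exists m, e, x; split=> // F /spanI[c [F0 [F0V FE]]] y.
  under eq_bigr do rewrite FE mulrDl.
  rewrite big_split /= -eE // FE; congr (_ + _).
  have /eqP := r0 y; rewrite subr_eq0 => /eqP ->; rewrite mulr_sumr.
  by apply: eq_bigr => j _; rewrite mulrA.
move=> /existsNP[y0 /eqP ry0]; pose p y := r y / r y0.
have rx j : r (x j) = 0.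
  rewrite /r (bigD1 j) //= ex eqxx mulr1 big1 ?addr0 ?subrr // => i ij.
  by rewrite ex (negbTE ij) mulr0.
have py0 : p y0 = 1 by rewrite /p divff.
have px j : p (x j) = 0 by rewrite /p rx mul0r.
have eC F a : span_of_Rd g F -> span_of_Rd g (fun y => a * F y).
  move=> [c ->]; exists (fun i => a * c i); apply/funext => y; rewrite mulr_sumr.
  by apply: eq_bigr => i _; rewrite mulrA.
have eD F G : span_of_Rd g F -> span_of_Rd g G -> span_of_Rd g (fun y => F y + G y).
  move=> [c ->] [c' ->]; exists (fun i => c i + c' i); apply/funext => y.
  by rewrite -big_split; apply: eq_bigr => i _; rewrite mulrDl.
have e_sum c : span_of_Rd (fun i => g (widen_ord (leqnSn n) i)) (fun y => \sum_j c j * e j y).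
  have /choice[a aE] : forall j, exists a : 'I_n -> R, e j = fun y => \sum_i a i * g (widen_ord (leqnSn n) i) y.
    by move=> j; have [a ->] := eV j; exists a.
  exists (fun i => \sum_j c j * a j i); apply/funext => y.
  under [RHS]eq_bigr do rewrite mulr_suml.
  rewrite exchange_big /=; apply: eq_bigr => j _.
  by rewrite [in LHS]aE mulr_sumr; apply: eq_bigr => i _; rewrite mulrA.
have pV : span_of_Rd g p.
  have := eC _ ((r y0)^-1) (spanS _ (e_sum (fun j => - u (x j))) 1).
  congr span_of_Rd; apply/funext => y; rewrite /p /r mul1r mulrC; congr (_ * _).
  by rewrite addrC -sumrN; congr (_ + _); apply: eq_bigr => j _; rewrite mulNr.
(* [p] is 1 at the new point and 0 at the old ones; subtracting its multiples makes the old
   functions vanish at the new point. *)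
pose e' (i : 'I_m.+1) y := if unlift ord_max i is Some j then e j y - e j y0 * p y else p y.
pose x' (i : 'I_m.+1) := if unlift ord_max i is Some j then x j else y0.
exists m.+1, e', x'; split.
- move=> i j; rewrite /e' /x'.
  case: unliftP => [i' ->|->]; case: unliftP => [j' ->|->].
  + by rewrite px mulr0 subr0 ex (inj_eq lift_inj).
  + by rewrite py0 mulr1 subrr eq_sym (negbTE (neq_lift _ _)).
  + by rewrite px (negbTE (neq_lift _ _)).
  + by rewrite py0 eqxx.
- move=> i; rewrite /e'; case: unlift => [j|//].
  have := eD _ _ (eS j) (eC _ (- e j y0) pV); congr span_of_Rd; apply/funext => y.
  by rewrite mulNr.
move=> F /spanI[c [F0 [F0V FE]]] y.
(* The new system reproduces G as soon as the interpolation error of G at the old points is a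
   multiple of [p]. For [F0] this error is zero, for [u] it is [r]. *)
have key G : (forall y, G y - \sum_j G (x j) * e j y = (G y0 - \sum_j G (x j) * e j y0) * p y) ->
    G y = \sum_j G (x' j) * e' j y.
  move=> GE; rewrite (bigD1_ord ord_max) //= /e' /x' unlift_none.
  under eq_bigr do rewrite liftK mulrBr mulrA.
  rewrite sumrB -mulr_suml.
  by have := GE y; rewrite mulrBl => h; lra.
have k1 := key F0; have k2 := key u.
under eq_bigr do rewrite FE mulrDl.
rewrite big_split /= -k1; last first.
  by move=> z; rewrite -!eE // !subrr mul0r.
under [X in _ + X]eq_bigr do rewrite -mulrA.
rewrite -mulr_sumr -k2 ?FE // => z.
by rewrite -/(r z) -/(r y0) /p mulrC divfK.
Qed.

(** The argument common to both cases, with [X] the set of points or the set of functions.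
    Continuity of orbits is asked only at [y] where some member of the span is nonzero: for
    distributions, which vanish off test functions, this makes [y] a test function. *)
Lemma invariant_span_polynomial (R : realType) (d : nat) (X : Type)
    (sh : pt R d -> X -> X) (ro : 'M[R]_d -> X -> X) (n : nat) (g : 'I_n -> X -> R) :
  (2 <= d)%N ->
  (forall h k y, sh (h + k) y = sh h (sh k y)) -> (forall y, sh 0 y = y) ->
  (forall P h y, in_group_Rd true P -> ro P (sh h y) = sh (matact_Rd P h) (ro P y)) ->
  (forall P y, in_group_Rd true P -> ro P^T (ro P y) = y) ->
  (forall h F, span_of_Rd g F -> span_of_Rd g (F \o sh h)) ->
  (forall P F, in_group_Rd true P -> span_of_Rd g F -> span_of_Rd g (F \o ro P)) ->
  (forall F G y i, span_of_Rd g F -> span_of_Rd g G -> G y != 0 ->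
     continuous (fun t : R => F (sh (t *: basis_Rd R i) y))) ->
  exists (m : nat) (e : 'I_m -> X -> R) (A : pt R d -> 'M[R]_m),
  [/\ forall i, span_of_Rd g (e i),
      forall F, span_of_Rd g F -> exists c : 'I_m -> R, forall y, F y = \sum_i c i * e i y,
      forall h i y, e i (sh h y) = \sum_j A h i j * e j y,
      (forall h k, A (h + k) = A h *m A k) /\ A 0 = 1%:M
    & forall i j, polynomial_fun _ _ (fun h => A h i j)].
Proof.
move=> d2 shD sh0 roS roT Vsh Vro Vc.
have [m [e [x [ex eV eE]]]] := span_dual_basis _ _ _ g.
pose A h : 'M[R]_m := \matrix_(i, j) e i (sh h (x j)).
pose C P : 'M[R]_m := \matrix_(i, j) e i (ro P (x j)).
have shE h i y : e i (sh h y) = \sum_j A h i j * e j y.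
  by rewrite -[LHS]/((e i \o sh h) y) (eE _ (Vsh h _ (eV i))); apply: eq_bigr => j _; rewrite mxE.
have roE P i y : in_group_Rd true P -> e i (ro P y) = \sum_j C P i j * e j y.
  by move=> GP; rewrite -[LHS]/((e i \o ro P) y) (eE _ (Vro P _ GP (eV i))); apply: eq_bigr => j _; rewrite mxE.
have AD h k : A (h + k) = A h *m A k.
  apply/matrixP => i j; rewrite !mxE shD shE; apply: eq_bigr => l _.
  by rewrite [A k l j]mxE.
have A0 : A 0 = 1%:M by apply/matrixP => i j; rewrite !mxE sh0 ex.
exists m, e, A; split=> //.
  by move=> F FV; exists (fun j => F (x j)) => y; exact: eE.
apply: rotation_invariant_hom_polynomial => // [P PP P1|i a b].
  have GP : in_group_Rd true P by [].
  have GPT : in_group_Rd true P^T.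
    by split; rewrite ?det_tr // trmxK; exact: mulmx1C.
  exists (C P).
    suff /mulmx1_unit[] : C P^T *m C P = 1%:M by [].
    apply/matrixP => i j; rewrite !mxE -ex -[in RHS](roT P (x j)) // roE //.
    by apply: eq_bigr => l _; rewrite [C P l j]mxE.
  move=> h; apply/matrixP => i j; rewrite !mxE.
  transitivity (e i (ro P (sh h (x j)))).
    by rewrite roE //; apply: eq_bigr => l _; rewrite [A h l j]mxE.
  by rewrite roS // shE; apply: eq_bigr => l _; rewrite [C P l j]mxE.
(* The point [x b] is admissible because [e b] equals 1 there. *)
have := Vc (e a) (e b) (x b) i (eV a) (eV b).
rewrite ex eqxx oner_eq0 => /(_ isT).
by rewrite (_ : (fun t : R => A (t *: basis_Rd R i) a b) =
  (fun t : R => e a (sh (t *: basis_Rd R i) (x b)))) //; apply/funext => t; rewrite mxE.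
Qed.

(** * The case of continuous functions *)

Lemma continuous_case (R : realType) (d : nat) (special : bool)
    (V : set (pt R d -> R)) (f : pt R d -> R) :
  (2 <= d)%N ->
  (exists (n : nat) (g : 'I_n -> pt R d -> R), V = span_of_Rd g) ->
  V `<=` @Cd R d ->
  (forall h : pt R d, forall F, V F -> V (tauC h F)) ->
  (forall P : 'M[R]_d, in_group_Rd special P -> forall F, V F -> V (OC P F)) ->
  V f -> polynomial_fun _ _ f.
Proof.
move=> d2 [n [g ->]] VC Vtau VO fV.
have [||||||F G y i FV _ _|m [e [A [eV VE eA _ Ap]]]] :=
  invariant_span_polynomial R d _ (fun h x => x + h) (@matact_Rd R d) n g d2.
- by move=> h k y; rewrite addrAC addrA.
- by move=> y; rewrite addr0.
- by move=> P h y _; rewrite /matact_Rd mulmxDl.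
- by move=> P y [PP _]; rewrite /matact_Rd -mulmxA trmxK (mulmx1C PP) mulmx1.
- by move=> h F /(Vtau h).
(* Whatever [special] is, the group contains SO(d). *)
- by move=> P F [PP P1] /VO; apply; split=> // _; exact: P1.
- move=> t; apply: (@continuous_comp _ _ _ (fun t : R => y + t *: basis_Rd R i) F).
    apply: cvgD; [exact: cvg_cst | apply: cvgZr_tmp; exact: cvg_id].
  exact: VC.
have [c fE] := VE f fV.
apply: (polynomial_fun_ext _ _ (fun h => \sum_i c i * \sum_j A h i j * e j 0)).
  move=> h; rewrite fE; apply: eq_bigr => i _.
  by rewrite -eA add0r.
apply: polynomial_fun_sum => i; apply: polynomial_funM; first exact: polynomial_fun_const.
apply: polynomial_fun_sum => j; apply: polynomial_funM; last exact: polynomial_fun_const.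
exact: Ap.
Qed.

(** * Integrals on the line *)

Section LineIntegrals.
Variable R : realType.
Let mu : {measure set (measurableTypeR R) -> \bar R} := @lebesgue_measure R.
Implicit Types (u : R -> R) (D : set (measurableTypeR R)).

Lemma integrable_compact_support u D (a b : R) : measurable D -> continuous u ->
  (forall s, ~ (a <= s <= b) -> u s = 0) -> mu.-integrable D (EFin \o u).
Proof.
move=> mD uc u0; apply: (@integrableS _ _ _ mu setT) => //.
have -> : EFin \o u = (EFin \o u) \_ `[a, b].
  apply/funext => s; rewrite /patch; case: ifPn => // /negP sab /=.
  rewrite u0 // => h; apply: sab; rewrite inE /=.
  by rewrite in_itv.
have mab : measurable (`[a, b]%classic : set (measurableTypeR R)) by exact: measurable_itv.
apply: (@integrable_mkcond _ _ _ mu _ (EFin \o u) mab).1.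
have := @continuous_compact_integrable R u `[a, b] (@segment_compact _ a b).
by apply; exact: continuous_subspaceT.
Qed.

Lemma Rintegral_bound u D (a b M : R) : measurable D -> continuous u ->
  (forall s, ~ (a <= s <= b) -> u s = 0) -> a <= b ->
  (forall s, `|u s| <= M) -> `|Rintegral mu D u| <= M * (b - a).
Proof.
move=> mD uc u0 ab uM.
have iu := integrable_compact_support u D a b mD uc u0.
have -> : Rintegral mu D u = Rintegral mu (D `&` `[a, b]) u.
  rewrite Rintegral_mkcondr; apply: eq_Rintegral => s _.
  rewrite /patch; case: ifPn => // /negP sab; rewrite u0 // => h; apply: sab.
  by rewrite inE /= in_itv.
have mI : measurable (D `&` `[a, b] : set (measurableTypeR R)) by exact: measurableI.
have iu' := integrable_compact_support u _ a b mI uc u0.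
apply: (le_trans (le_normr_Rintegral mI iu')).
have M0 : 0 <= M by apply: le_trans (uM 0).
have fin : (mu (D `&` `[a, b]) <= (b - a)%:E)%E.
  have h : (mu (D `&` `[a, b]) <= mu `[a, b]%classic)%E by apply: le_measure; rewrite ?inE.
  apply: (le_trans h).
  have -> := (lebesgue_measure_itv `[a, b] : mu `[a, b]%classic = _).
  by rewrite /= lte_fin; case: ltP => // _; rewrite lee_fin subr_ge0.
apply: (@le_trans _ _ (Rintegral mu (D `&` `[a, b]) (fun=> M))).
  apply: le_Rintegral => //.
  - by have := integrable_norm iu'.
  - apply/integrableP; split; first exact: measurable_cst.
    rewrite integral_cst // lte_mul_pinfty // ?lee_fin //.
    by apply: le_lt_trans fin _; rewrite ltry.
rewrite Rintegral_cst // ler_wpM2l //.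
by rewrite -lee_fin fineK // ge0_fin_numE // (le_lt_trans fin) ?ltry.
Qed.

Let shift_by (t : R) : measurableTypeR R -> measurableTypeR R := fun s : R => s + t.

Let measurable_shift t : measurable_fun setT (shift_by t).
Proof.
have : continuous (fun s : R => s + t).
  by move=> s; apply: cvgD; [exact: cvg_id | exact: cvg_cst].
by move/continuous_measurable_fun.
Qed.

(** By uniqueness of Lebesgue measure it is enough to compare lengths of half-open intervals. *)
Let lebesgue_measure_shift (t : R) (A : set (measurableTypeR R)) : measurable A ->
  mu A = pushforward mu (shift_by t) A.
Proof.
move=> mA; apply: (@lebesgue_measure_unique R (pushforward mu (shift_by t))) => //.
move=> _ [[a b] _ <-] /=; rewrite /pushforward.
have -> : shift_by t @^-1` `]a, b]%classic = `]a - t, b - t]%classic.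
  by apply/seteqP; split => s /=; rewrite !in_itv /= ltrBlDr lerBrDr.
rewrite [LHS]lebesgue_measure_itv.
transitivity (lebesgue_measure (`]a - t, b - t]%classic : set (measurableTypeR R))); last by [].
rewrite [RHS]lebesgue_measure_itv /= !lte_fin ltrD2r.
case: ifPn => // _; rewrite -!EFinD; congr EFin; ring.
Qed.

Lemma Rintegral_shift u D (a b t : R) : measurable D -> continuous u ->
  (forall s, ~ (a <= s <= b) -> u s = 0) ->
  Rintegral mu [set s | D (s + t)] (fun s => u (s + t)) = Rintegral mu D u.
Proof.
move=> mD uc u0; rewrite /Rintegral; congr fine.
have mD' : measurable ([set s | D (s + t)] : set (measurableTypeR R)).
  by have := measurable_shift t measurableT D mD; rewrite setTI.
have h := @integral_pushforward _ _ _ _ R (shift_by t) (measurable_shift t) mu D (EFin \o u).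
rewrite -[LHS]h //.
- by apply: eq_measure_integral => A mA _; apply/esym; exact: lebesgue_measure_shift.
- by apply/measurable_EFinP; exact: continuous_measurable_fun.
- apply: (integrable_compact_support (fun s => u (s + t)) _ (a - t) (b - t)) => //.
    move=> s; apply: (@continuous_comp _ _ _ (fun s : R => s + t) u); last exact: uc.
    by apply: cvgD; [exact: cvg_id | exact: cvg_cst].
  by move=> s sab; apply: u0 => /andP[h1 h2]; apply: sab; apply/andP; split; lra.
Qed.

End LineIntegrals.

(** * Calculus on R^d *)

Section EuclideanSpace.
Variables (R : realType) (d : nat).
Local Notation pt := (pt R d).
Local Notation e_ k := (basis_Rd R k : pt).
Implicit Types (x y h : pt) (g f : pt -> R) (k j : 'I_d).

Lemma norm_coord_le x k : `|x 0 k| <= `|x|.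
Proof.
rewrite /Num.norm /= mx_normrE.
exact: (le_bigmax _ (fun ij : 'I_1 * 'I_d => `|x ij.1 ij.2|) (0, k)).
Qed.

Lemma norm_rV_le x (M : R) : 0 <= M -> (forall k, `|x 0 k| <= M) -> `|x| <= M.
Proof.
move=> M0 xM; rewrite /Num.norm /= mx_normrE; apply/bigmax_leP; split=> // -[i k] _ /=.
by rewrite ord1.
Qed.

Lemma basis_coord k j : e_ k 0 j = (k == j)%:R.
Proof. by rewrite mxE /= eq_sym. Qed.

Lemma norm_basis_le (t : R) k : `|t *: e_ k| <= `|t|.
Proof.
apply: norm_rV_le => // j; rewrite mxE basis_coord.
by case: eqP => _; rewrite ?mulr1 ?mulr0 ?normr0.
Qed.

Definition supported_in (r : R) g := forall x, r < `|x| -> g x = 0.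

Lemma compact_norm_le (r : R) : compact [set x : pt | `|x| <= r].
Proof.
apply: bounded_closed_compact.
  by exists r; split; rewrite ?num_real // => M rM x /= /le_trans; apply; exact: ltW.
have -> : [set x : pt | `|x| <= r] = (fun x : pt => `|x|) @^-1` [set t | t <= r] by [].
by apply: closed_comp; [move=> x _; exact: norm_continuous | exact: closed_le].
Qed.

Lemma continuous_bounded_on g (r : R) : continuous g ->
  exists2 M : R, 0 < M & forall x, `|x| <= r -> `|g x| <= M.
Proof.
move=> gc; have cg : compact (g @` [set x : pt | `|x| <= r]).
  apply: continuous_compact; last exact: compact_norm_le.
  exact: continuous_subspaceT.
have [M [_ MP]] := compact_bounded cg.
exists (`|M| + 1) => [|x xr]; first by rewrite ltr_wpDl.
by apply: (MP (`|M| + 1)); [rewrite ltr_pwDr // ler_norm | exists x].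
Qed.

(** Compactness of the ball of radius r + 1 gives a uniform delta there. Capping it at 1 makes both
    values vanish when x lies outside that ball. *)
Lemma compactly_supported_unif_continuous g r : continuous g -> supported_in r g ->
  forall e : R, 0 < e -> exists2 del : R, 0 < del & forall x h, `|h| < del -> `|g (x + h) - g x| < e.
Proof.
move=> gc gr e e0.
pose K := [set x : pt | `|x| <= r + 1]; have cK : compact K := compact_norm_le (r + 1).
have /compact_near_coveringP nc := cK.
suff : \forall h \near (0 : pt), K `<=` (fun x => `|g (x + h) - g x| < e).
  case/nbhs_ballP.
  move=> del /= del0 dP; exists (Num.min del 1); first by rewrite lt_min del0 ltr01.
  move=> x h; rewrite lt_min => /andP[hd h1].
  have [xK|xK] := leP `|x| (r + 1).
    apply: dP; last exact: xK; rewrite mx_norm_ball /ball_ /= sub0r normrN //.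
  have xh : r < `|x + h|.
    by have := ler_normB (x + h) h; rewrite addrK; lra.
  by rewrite !gr ?subrr ?normr0 //; lra.
have := nc pt (nbhs (0 : pt)) (fun h x => `|g (x + h) - g x| < e) (nbhs_filter _).
apply.
move=> x xK.
have /cvgrPdist_lt/(_ (e / 2)) := gc x; rewrite divr_gt0 // => /(_ isT) /nbhs_ballP[del /= del0 dP].
have gx y : `|x - y| < del -> `|g x - g y| < e / 2.
  by move=> xy; apply: dP; rewrite mx_norm_ball.
exists (ball x (del / 2), ball 0 (del / 2)).
  by split; apply: nbhsx_ballx; rewrite divr_gt0.
move=> [x' h] [/=]; rewrite mx_norm_ball /ball_ /= sub0r normrN => xx' hd.
have a1 : `|g x - g x'| < e / 2 by apply: gx; lra.
have a2 : `|g x - g (x' + h)| < e / 2.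
  by apply: gx; have := ler_normB (x - x') h; rewrite opprD addrA; lra.
have := ler_normB (g x - g x') (g x - g (x' + h)).
by rewrite (_ : g x - g x' - (g x - g (x' + h)) = g (x' + h) - g x'); [lra | ring].
Qed.

End EuclideanSpace.

(** * Continuity and differentiation of integrals along lines *)

Section Calculus.
Variables (R : realType) (d : nat).
Local Notation pt := (pt R d).
Local Notation e_ k := (basis_Rd R k : pt).
Implicit Types (x y h : pt) (g f : pt -> R) (k j : 'I_d) (D : set (measurableTypeR R)).
Local Notation supported_in := (supported_in R d).

Lemma continuous_eps g : (forall x (e : R), 0 < e -> exists2 del : R, 0 < del &
    forall h, `|h| < del -> `|g (x + h) - g x| <= e) -> continuous g.
Proof.
move=> H x; apply/(@cvgrPdist_le _ _ _ (nbhs x) (nbhs_filter x)) => e /(H x)[del del0 dP].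
apply/nbhs_ballP; exists del => // y; rewrite mx_norm_ball /ball_ /= distrC => yd.
by rewrite distrC -[y](subrK x) [y - x + x]addrC; exact: dP.
Qed.

Lemma continuous_addf f g : continuous f -> continuous g -> continuous (fun x => f x + g x).
Proof.
by move=> fc gc x; exact: (@cvgD _ _ _ (nbhs x) (nbhs_filter x) _ _ _ _ (fc x) (gc x)).
Qed.

Lemma continuous_mulf f g : continuous f -> continuous g -> continuous (fun x => f x * g x).
Proof.
by move=> fc gc x; exact: (@cvgM _ _ (nbhs x) (nbhs_filter x) _ _ _ _ (fc x) (gc x)).
Qed.

Lemma continuous_scalef f (c : R) : continuous f -> continuous (fun x => c * f x).
Proof.
apply: (continuous_mulf (fun=> c)); apply: continuous_eps => x e e0.
by exists 1 => // h _; rewrite subrr normr0 ltW.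
Qed.

Lemma is_derive_eps f x (v : pt) (l : R) :
  (forall e : R, 0 < e -> exists2 del : R, 0 < del & forall h : R, h != 0 -> `|h| < del ->
     `|h^-1 * (f (h *: v + x) - f x) - l| <= e) ->
  is_derive x v f l.
Proof.
move=> H.
have c : (fun h : R => h^-1 *: ((f \o shift x) (h *: v) - f x)) @ 0^' --> l.
  apply/cvgrPdist_le => e /H[del del0 dP].
  exists del => //= h /= hd h0; rewrite distrC; apply: dP => //.
  by move: hd; rewrite sub0r normrN.
by apply: DeriveDef; [apply/cvg_ex; exists l | exact: cvg_lim c].
Qed.

Lemma is_derive_line f x (v : pt) (t : R) (l : R) :
  is_derive (t *: v + x) v f l -> is_derive t (1 : R) (fun s : R => f (s *: v + x)) l.
Proof.
have E : (fun h : R => h^-1 *: (((fun s : R => f (s *: v + x)) \o shift t) (h *: 1) - f (t *: v + x)))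
   = (fun h : R => h^-1 *: ((f \o shift (t *: v + x)) (h *: v) - f (t *: v + x))).
  by apply/funext => h /=; rewrite scalerDl -addrA [h *: 1]mulr1.
by move=> [d1 d2]; apply: DeriveDef; [rewrite /derivable E | rewrite -d2 /derive E].
Qed.

(** By the mean value theorem the difference quotient is a value of f' on the segment. A modulus of
    uniform continuity of f' thus bounds the error independently of x, as differentiation under the
    integral requires. *)
Lemma derive_mean_bound f (f' : pt -> R) x (v : pt) (h e : R) :
  (forall y, is_derive y v f (f' y)) -> h != 0 ->
  (forall t : R, `|t| <= `|h| -> `|f' (t *: v + x) - f' x| <= e) ->
  `|h^-1 * (f (h *: v + x) - f x) - f' x| <= e.
Proof.
move=> df h0 He; pose u (t : R) := f (t *: v + x); pose u' (t : R) := f' (t *: v + x).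
have du (t : R) : is_derive t (1 : R) u (u' t) by exact: is_derive_line.
have uc : continuous u.
  by move=> t; apply/differentiable_continuous/derivable1_diffP; exact: ex_derive.
have u0 : u 0 = f x by rewrite /u scale0r add0r.
have [t th uE] : exists2 t, `|t| <= `|h| & u h - u 0 = u' t * h.
  have [hp|hn|hE] := ltgtP 0 h; last by move: h0; rewrite -hE eqxx.
    have [c] := MVT hp (fun t _ => du t) (continuous_subspaceT uc).
    rewrite in_itv /= subr0 => /andP[c0 ch] E; exists c => //.
    by rewrite !gtr0_norm // ltW.
  have [c] := MVT hn (fun t _ => du t) (continuous_subspaceT uc).
  rewrite in_itv /= sub0r => /andP[c0 ch] E; exists c.
    by rewrite !ltr0_norm // lerN2 ltW.
  by rewrite -opprB E mulrN opprK.
by rewrite -/(u h) -u0 uE mulrC mulfK //; exact: He.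
Qed.

(** The parameter is measured from x. Hence []-oo, 0]] gives the primitive along the axis, []0, a]]
    its increments, and [setT] the total integral over the line. *)
Definition line_integral D k g : pt -> R :=
  fun x => Rintegral (@lebesgue_measure R) D (fun s => g (x + s *: e_ k)).

Lemma continuous_slice g k x : continuous g -> continuous (fun s : R => g (x + s *: e_ k)).
Proof.
move=> gc s; apply: (@continuous_comp _ _ _ (fun s : R => x + s *: e_ k) g); last exact: gc.
by apply: cvgD; [exact: cvg_cst | apply: cvgZr_tmp; exact: cvg_id].
Qed.

Lemma slice_support g r k x (M : R) : supported_in r g -> r + `|x| <= M ->
  forall s : R, ~ (- M <= s <= M) -> g (x + s *: e_ k) = 0.
Proof.
move=> gr rM s sM; apply: gr.
have sM' : M < `|s| by rewrite ltNge; apply/negP => h; apply: sM; rewrite -ler_norml.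
have h1 := norm_coord_le R d (x + s *: e_ k) k; have h2 := norm_coord_le R d x k.
move: h1; rewrite mxE [X in _ + X]mxE basis_coord eqxx mulr1 => h1.
have := ler_normB (x 0 k + s) (x 0 k).
by rewrite (_ : x 0 k + s - x 0 k = s); [lra | ring].
Qed.

Lemma slice_integrable g r k x D : measurable D -> continuous g -> supported_in r g ->
  (@lebesgue_measure R).-integrable D (EFin \o (fun s => g (x + s *: e_ k))).
Proof.
move=> mD gc gr.
apply: (integrable_compact_support _ _ _ (- (r + `|x|)) (r + `|x|)) => //.
  exact: continuous_slice.
by apply: slice_support gr _.
Qed.

Lemma line_integral_bound g r k x D (M e : R) : measurable D -> continuous g ->
  supported_in r g -> 0 <= M -> r + `|x| <= M -> (forall y, `|g y| <= e) ->
  `|line_integral D k g x| <= e * (2 * M).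
Proof.
move=> mD gc gr M0 rM ge.
have -> : 2 * M = M - (- M) by ring.
apply: Rintegral_bound => //; first exact: continuous_slice.
  by apply: slice_support gr rM.
by rewrite -subr_ge0 opprK addr_ge0.
Qed.

Lemma line_integralD g f r k D x : measurable D -> continuous g -> continuous f ->
  supported_in r g -> supported_in r f ->
  line_integral D k (fun y => g y + f y) x = line_integral D k g x + line_integral D k f x.
Proof.
by move=> mD gc fc gr fr; rewrite /line_integral RintegralD //; exact: (slice_integrable _ r).
Qed.

Lemma line_integralZ g r k D x (c : R) : measurable D -> continuous g -> supported_in r g ->
  line_integral D k (fun y => c * g y) x = c * line_integral D k g x.
Proof. by move=> mD gc gr; rewrite /line_integral RintegralZl //; exact: (slice_integrable _ r). Qed.

Lemma continuous_translate g h : continuous g -> continuous (fun x => g (x + h)).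
Proof.
move=> gc x; apply: (@continuous_comp _ _ _ (fun x : pt => x + h) g); last exact: gc.
exact: (@cvgD _ _ _ (nbhs x) (nbhs_filter x) (fun z => z) (fun=> h) _ _ cvg_id (cvg_cst _)).
Qed.

Lemma supported_in_translate g r h : supported_in r g -> supported_in (r + `|h|) (fun x => g (x + h)).
Proof.
move=> gr x rx; apply: gr; have := ler_normB (x + h) h; rewrite addrK; lra.
Qed.

Lemma supported_inW g (r r' : R) : r <= r' -> supported_in r g -> supported_in r' g.
Proof. by move=> rr gr x /(le_lt_trans rr); exact: gr. Qed.

Lemma line_integral_translate g k D x h :
  line_integral D k g (x + h) = line_integral D k (fun y => g (y + h)) x.
Proof. by apply: eq_Rintegral => s _; rewrite addrAC. Qed.

Lemma continuous_line_integral g r k D : measurable D -> continuous g -> supported_in r g ->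
  continuous (line_integral D k g).
Proof.
move=> mD gc gr; apply: continuous_eps => x e e0.
(* On the line through x, the integrand and its translates by |h| < 1 live in the window [-M, M], of
   length 2 * M; hence the tolerance e / (2 * M). *)
pose M := `|r| + 1 + `|x| + 1.
have M0 : 0 < M by rewrite /M; have := normr_ge0 r; have := normr_ge0 x; lra.
have [|del del0 dP] := compactly_supported_unif_continuous R d _ _ gc gr (e / (2 * M)).
  by rewrite divr_gt0 // mulr_gt0.
exists (Num.min del 1) => [/=|h]; first by rewrite lt_min del0 ltr01.
rewrite lt_min => /andP[hd h1]; rewrite line_integral_translate.
have gr' : supported_in (`|r| + 1) g.
  by apply: supported_inW gr; have := ler_norm r; lra.
have gr'' : supported_in (`|r| + 1) (fun z => -1 * g z).
  by move=> z /gr' ->; rewrite mulr0.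
have hr : supported_in (`|r| + 1) (fun z => g (z + h)).
  by apply: supported_inW (supported_in_translate _ _ _ gr); have := ler_norm r; lra.
rewrite -[X in _ - X]mul1r -mulNr -(line_integralZ _ _ _ _ _ _ mD gc gr).
have gc' := continuous_scalef g (-1) gc.
rewrite -(line_integralD _ _ _ _ _ _ mD (continuous_translate _ h gc) gc' hr gr'').
have -> : e = e / (2 * M) * (2 * M) by rewrite divfK // mulf_neq0 // gt_eqF.
apply: (line_integral_bound _ (`|r| + 1)) => //.
- by apply: continuous_addf => //; exact: continuous_translate.
- by move=> z zr; rewrite hr // gr' // mulr0 addr0.
- exact: ltW.
- by rewrite /M; lra.
- by move=> z; rewrite mulN1r ltW // dP.
Qed.

Lemma is_derive_line_integral g (g' : pt -> R) r k j D x : measurable D ->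
  continuous g -> continuous g' -> supported_in r g -> supported_in r g' ->
  (forall y, is_derive y (e_ j) g (g' y)) ->
  is_derive x (e_ j) (line_integral D k g) (line_integral D k g' x).
Proof.
move=> mD gc gc' gr gr' dg; apply: is_derive_eps => e e0.
pose M := `|r| + 1 + `|x| + 1.
have M0 : 0 < M by rewrite /M; have := normr_ge0 r; have := normr_ge0 x; lra.
have [|del del0 dP] := compactly_supported_unif_continuous R d _ _ gc' gr' (e / (2 * M)).
  by rewrite divr_gt0 // mulr_gt0.
exists (Num.min del 1) => [/=|h h0]; first by rewrite lt_min del0 ltr01.
rewrite lt_min => /andP[hd h1].
have hb := norm_basis_le R d h j.
rewrite [_ + x]addrC line_integral_translate.
have r1 : supported_in (`|r| + 1) g by apply: supported_inW gr; have := ler_norm r; lra.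
have r2 : supported_in (`|r| + 1) (fun z => g (z + h *: e_ j)).
  by apply: supported_inW (supported_in_translate _ _ _ gr); have := ler_norm r; lra.
have r3 : supported_in (`|r| + 1) g' by apply: supported_inW gr'; have := ler_norm r; lra.
have cZ := continuous_scalef; have cD := continuous_addf.
have rZ (c : R) f : supported_in (`|r| + 1) f -> supported_in (`|r| + 1) (fun z => c * f z).
  by move=> fr z /fr ->; rewrite mulr0.
have rD f1 f2 : supported_in (`|r| + 1) f1 -> supported_in (`|r| + 1) f2 ->
    supported_in (`|r| + 1) (fun z => f1 z + f2 z).
  by move=> f1r f2r z zr; rewrite f1r // f2r // addr0.
have tc := continuous_translate _ (h *: e_ j) gc.
have c1 := cZ _ (-1) gc; have c2 := cD _ _ tc c1; have c3 := cZ _ h^-1 c2.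
have c4 := cZ _ (-1) gc'; have r4 := rZ (-1) _ r1; have r5 := rD _ _ r2 r4.
have r6 := rZ h^-1 _ r5; have r7 := rZ (-1) _ r3.
have -> : h^-1 * (line_integral D k (fun y => g (y + h *: e_ j)) x - line_integral D k g x) -
    line_integral D k g' x =
  line_integral D k (fun y => h^-1 * (g (y + h *: e_ j) + -1 * g y) + -1 * g' y) x.
  rewrite [RHS](line_integralD _ _ (`|r| + 1)) // (line_integralZ _ (`|r| + 1)) //.
  rewrite (line_integralD _ _ (`|r| + 1)) //.
  by rewrite !(line_integralZ _ (`|r| + 1)) // !mulN1r.
have -> : e = e / (2 * M) * (2 * M) by rewrite divfK // mulf_neq0 // gt_eqF.
apply: (line_integral_bound _ (`|r| + 1)) => //.
- exact: cD.
- exact: rD.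
- exact: ltW.
- by rewrite /M; lra.
move=> y; rewrite !mulN1r [y + _]addrC.
apply: derive_mean_bound => // t th.
rewrite [_ + y]addrC ltW // dP //.
by apply: le_lt_trans (norm_basis_le _ _ _ _) _; lra.
Qed.

End Calculus.

(** * Smooth functions *)

Section SmoothFunctions.
Variables (R : realType) (d : nat).
Local Notation pt := (pt R d).
Local Notation e_ k := (basis_Rd R k : pt).
Implicit Types (x y h : pt) (g f : pt -> R) (k j : 'I_d) (D : set (measurableTypeR R)).
Local Notation supported_in := (supported_in R d).
Local Notation smooth := (@smooth_Rd R d).
Local Notation pder := (@pder_Rd R d).
Local Notation test_fun := (@test_fun_Rd R d).
Local Notation line_integral := (line_integral R d).

Lemma derive_fun f f' k : (forall x, is_derive x (e_ k) f (f' x)) -> 'D_(e_ k) f = f'.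
Proof. by move=> df; apply/funext => x; exact: (@derive_val _ _ _ _ _ _ _ (df x)). Qed.

(** Coinduction: a class of continuous functions closed under partial derivatives contains all
    iterated derivatives of its members. No formula for iterated derivatives is then required. *)
Lemma smooth_coind (P : (pt -> R) -> Prop) :
  (forall f, P f -> continuous f /\
     forall j, exists2 f', P f' & forall x, is_derive x (e_ j) f (f' x)) ->
  forall f, P f -> smooth f.
Proof.
move=> HP f Pf; have Ps s : P (pder s f).
  elim: s => [//|j s IH] /=; have [_ /(_ j)[f' Pf' /derive_fun ->]] := HP _ IH.
  exact: Pf'.
split=> [s|s j x]; first exact: (HP _ (Ps s)).1.
by have [_ /(_ j)[f' _ df]] := HP _ (Ps s); exact: (@ex_derive _ _ _ _ _ _ _ (df x)).
Qed.

Lemma smooth_continuous f : smooth f -> continuous f.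
Proof. by move=> [/(_ [::])]. Qed.

Lemma smooth_is_derive f x k : smooth f -> is_derive x (e_ k) f ('D_(e_ k) f x).
Proof. by move=> [_ /(_ [::] k x) df]; exact: derivableP. Qed.

Lemma pder_rcons s j f : pder (rcons s j) f = pder s ('D_(e_ j) f).
Proof. by elim: s => [//|i s IH] /=; rewrite IH. Qed.

Lemma smooth_derive f k : smooth f -> smooth ('D_(e_ k) f).
Proof.
move=> [fc df]; split=> [s|s j x]; first by rewrite -pder_rcons.
by rewrite -pder_rcons.
Qed.

Lemma smooth_pder s f : smooth f -> smooth (pder s f).
Proof. by move=> sf; elim: s => [//|k s IH] /=; exact: smooth_derive. Qed.

(** The product rule leads from a product to a sum of products, so products alone are not closed
    under derivatives; this closure is, and [smooth_coind] applies to it. *)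
Inductive smooth_algebra : (pt -> R) -> Prop :=
  | SmoothGen f : smooth f -> smooth_algebra f
  | SmoothAdd f g : smooth_algebra f -> smooth_algebra g -> smooth_algebra (fun x => f x + g x)
  | SmoothMul f g : smooth_algebra f -> smooth_algebra g -> smooth_algebra (fun x => f x * g x).

Lemma smooth_algebraP f : smooth_algebra f -> smooth f.
Proof.
apply: smooth_coind => {}f; elim=> [{}f sf|{}f g sf [fc df] sg [gc dg]|{}f g sf [fc df] sg [gc dg]].
- split=> [|j]; first exact: smooth_continuous.
  exists ('D_(e_ j) f); first exact/SmoothGen/smooth_derive.
  by move=> x; exact: smooth_is_derive.
- split=> [|j]; first exact: continuous_addf.
  have [f' sf' f'E] := df j; have [g' sg' g'E] := dg j.
  exists (fun x => f' x + g' x); first exact: SmoothAdd.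
  by move=> x; exact: is_deriveD.
- split=> [|j]; first exact: continuous_mulf.
  have [f' sf' f'E] := df j; have [g' sg' g'E] := dg j.
  exists (fun x => f x * g' x + g x * f' x).
    by apply: SmoothAdd; exact: SmoothMul.
  by move=> x; exact: is_deriveM.
Qed.

Lemma smooth_add f g : smooth f -> smooth g -> smooth (fun x => f x + g x).
Proof. by move=> sf sg; apply: smooth_algebraP; apply: SmoothAdd; exact: SmoothGen. Qed.

Lemma smooth_mul f g : smooth f -> smooth g -> smooth (fun x => f x * g x).
Proof. by move=> sf sg; apply: smooth_algebraP; apply: SmoothMul; exact: SmoothGen. Qed.

Lemma smooth_const (c : R) : smooth (fun=> c).
Proof.
apply: (smooth_coind (fun f => exists c, f = fun=> c)); last by exists c.
move=> _ [{}c ->]; split=> [|j]; first exact: cst_continuous.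
by exists (fun=> 0); [exists 0 | move=> x; exact: is_derive_cst].
Qed.

Lemma smooth_scale (c : R) f : smooth f -> smooth (fun x => c * f x).
Proof. by move=> sf; exact: (smooth_mul _ _ (smooth_const c) sf). Qed.

Lemma smooth_coord k : smooth (fun x => x 0 k).
Proof.
apply: (smooth_coind (fun f => (exists c, f = fun=> c) \/ f = fun x => x 0 k)); last by right.
move=> _ [[c ->]|->]; (split=> [|j]).
- exact: cst_continuous.
- by exists (fun=> 0); [left; exists 0 | move=> x; exact: is_derive_cst].
- exact: coord_continuous.
exists (fun=> (j == k)%:R); first by left; eexists.
move=> x; apply: is_derive_eps => e e0; exists 1 => // h h0 _.
have -> : (h *: e_ j + x) 0 k = h * (j == k)%:R + x 0 k.
  by rewrite mxE [X in X + _]mxE basis_coord.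
rewrite addrK mulrA mulVf // mul1r subrr normr0.
exact: ltW.
Qed.

Lemma smooth_ext f g : f =1 g -> smooth f -> smooth g.
Proof. by move=> /funext ->. Qed.

Lemma smooth_sum (I : Type) (r : seq I) (P : pred I) (F : I -> pt -> R) :
  (forall i, smooth (F i)) -> smooth (fun x => \sum_(i <- r | P i) F i x).
Proof.
move=> FP; elim: r => [|i r IH].
  by apply: smooth_ext (smooth_const 0) => x; rewrite big_nil.
have := smooth_add _ _ (FP i) IH; case Pi : (P i) => H.
  by apply: smooth_ext H => x; rewrite big_cons Pi.
by apply: smooth_ext IH => x; rewrite big_cons Pi.
Qed.

Lemma smooth_prod (I : Type) (r : seq I) (P : pred I) (F : I -> pt -> R) :
  (forall i, smooth (F i)) -> smooth (fun x => \prod_(i <- r | P i) F i x).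
Proof.
move=> FP; elim: r => [|i r IH].
  by apply: smooth_ext (smooth_const 1) => x; rewrite big_nil.
have := smooth_mul _ _ (FP i) IH; case Pi : (P i) => H.
  by apply: smooth_ext H => x; rewrite big_cons Pi.
by apply: smooth_ext IH => x; rewrite big_cons Pi.
Qed.

Lemma smooth_exp f n : smooth f -> smooth (fun x => f x ^+ n).
Proof.
move=> sf; elim: n => [|n IH]; first exact: smooth_const.
by apply: smooth_ext (smooth_mul _ _ sf IH) => x; rewrite exprS.
Qed.

Lemma smooth_polynomial_fun f : polynomial_fun R d f -> smooth f.
Proof.
move=> [p /funext ->]; rewrite /polyfun_Rd.
apply: (smooth_ext (fun x => \sum_(m <- msupp p) mcoeff m p * \prod_i x 0 i ^+ m i)).
  by move=> x; rewrite mevalE.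
apply: smooth_sum => m; apply: smooth_mul; first exact: smooth_const.
apply: smooth_prod => i; apply: smooth_exp; exact: smooth_coord.
Qed.

Lemma is_derive_translate f x h k (l : R) : is_derive (x + h) (e_ k) f l ->
  is_derive x (e_ k) (fun y => f (y + h)) l.
Proof.
have E : (fun t : R => t^-1 *: (((fun y => f (y + h)) \o shift x) (t *: e_ k) - f (x + h)))
   = (fun t : R => t^-1 *: ((f \o shift (x + h)) (t *: e_ k) - f (x + h))).
  by apply/funext => t /=; rewrite addrA.
by move=> [d1 d2]; apply: DeriveDef; [rewrite /derivable E | rewrite -d2 /derive E].
Qed.

Lemma pder_translate s f h : smooth f ->
  pder s (fun x => f (x + h)) = fun x => pder s f (x + h).
Proof.
move=> sf; elim: s => [//|k s IH] /=; rewrite IH; apply: derive_fun => x.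
by apply: is_derive_translate; apply: smooth_is_derive; exact: smooth_pder.
Qed.

Lemma smooth_translate f h : smooth f -> smooth (fun x => f (x + h)).
Proof.
move=> sf; apply: (smooth_coind (fun g => exists2 f, smooth f & g = fun x => f (x + h)));
  last by exists f.
move=> _ [{sf}f sf ->]; split; first exact/continuous_translate/smooth_continuous.
move=> j; exists (fun x => 'D_(e_ j) f (x + h)).
  exact: (ex_intro2 _ _ _ (smooth_derive _ j sf) erefl).
by move=> x; apply: is_derive_translate; exact: smooth_is_derive.
Qed.

Lemma pder_add s f g : smooth f -> smooth g ->
  pder s (fun x => f x + g x) = fun x => pder s f x + pder s g x.
Proof.
move=> sf sg; elim: s => [//|k s IH] /=; rewrite IH; apply: derive_fun => x.
by apply: is_deriveD; apply: smooth_is_derive; exact: smooth_pder.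
Qed.

Lemma pder_scale s (c : R) f : smooth f ->
  pder s (fun x => c * f x) = fun x => c * pder s f x.
Proof.
move=> sf; elim: s => [//|k s IH] /=; rewrite IH; apply: derive_fun => x.
by apply: is_deriveZ; apply: smooth_is_derive; exact: smooth_pder.
Qed.

Lemma supported_in_derive r f k : supported_in r f -> supported_in r ('D_(e_ k) f).
Proof.
move=> fr x rx; apply: (@derive_val _ _ _ _ _ _ _ (_ : is_derive x (e_ k) f 0)).
apply: is_derive_eps => e e0; exists (`|x| - r) => [|h h0 hx]; first by rewrite subr_gt0.
have := norm_basis_le R d h k; have := ler_normB (h *: e_ k + x) (h *: e_ k).
rewrite [in X in X <= _ -> _]addrAC subrr add0r => h1 h2.
by rewrite !fr ?subr0 ?mulr0 ?subrr ?normr0 ?ltW //; lra.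
Qed.

Lemma supported_in_pder r s f : supported_in r f -> supported_in r (pder s f).
Proof. by move=> fr; elim: s => [//|k s IH] /=; exact: supported_in_derive. Qed.

Lemma pder_line_integral s f r k D : measurable D -> smooth f -> supported_in r f ->
  pder s (line_integral D k f) = line_integral D k (pder s f).
Proof.
move=> mD sf fr; elim: s => [//|j s IH] /=; rewrite IH; apply: derive_fun => x.
have sp := smooth_pder s _ sf; have spr := supported_in_pder r s _ fr.
apply: (is_derive_line_integral _ _ _ _ r) => //.
- exact: smooth_continuous.
- exact/smooth_continuous/smooth_derive.
- exact: supported_in_derive.
- by move=> y; exact: smooth_is_derive.
Qed.

Lemma smooth_line_integral f r k D : measurable D -> smooth f -> supported_in r f ->
  smooth (line_integral D k f).
Proof.
move=> mD sf fr; apply: (smooth_coind (fun g => exists f, [/\ smooth f, supported_in r f &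
    g = line_integral D k f])); last by exists f.
move=> _ [{sf fr}f [sf fr ->]]; split.
  by apply: (continuous_line_integral _ _ _ r) => //; exact: smooth_continuous.
move=> j; exists (line_integral D k ('D_(e_ j) f)).
  by exists ('D_(e_ j) f); split; [exact: smooth_derive | exact: supported_in_derive | ].
move=> x; apply: (is_derive_line_integral _ _ _ _ r) => //.
- exact: smooth_continuous.
- exact/smooth_continuous/smooth_derive.
- exact: supported_in_derive.
- by move=> y; exact: smooth_is_derive.
Qed.

End SmoothFunctions.

(** * Test functions *)

Section TestFunctions.
Variables (R : realType) (d : nat).
Local Notation pt := (pt R d).
Local Notation e_ k := (basis_Rd R k : pt).
Implicit Types (x y h : pt) (g f phi psi : pt -> R) (k j : 'I_d) (D : set (measurableTypeR R)).
Local Notation supported_in := (supported_in R d).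
Local Notation smooth := (@smooth_Rd R d).
Local Notation pder := (@pder_Rd R d).
Local Notation test_fun := (@test_fun_Rd R d).
Local Notation line_integral := (line_integral R d).

Lemma test_fun_add phi psi : test_fun phi -> test_fun psi -> test_fun (fun x => phi x + psi x).
Proof.
move=> [sp [r pr]] [sq [r' qr]]; split; first exact: smooth_add.
by exists (Num.max r r') => x; rewrite gt_max => /andP[h1 h2]; rewrite pr // qr // addr0.
Qed.

Lemma test_fun_mul g phi : smooth g -> test_fun phi -> test_fun (fun x => g x * phi x).
Proof.
move=> sg [sp [r pr]]; split; first exact: smooth_mul.
by exists r => x /pr ->; rewrite mulr0.
Qed.

Lemma test_fun_scale (c : R) phi : test_fun phi -> test_fun (fun x => c * phi x).
Proof. by apply: test_fun_mul; exact: smooth_const. Qed.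

Lemma test_fun_translate phi h : test_fun phi -> test_fun (fun x => phi (x + h)).
Proof.
move=> [sp [r pr]]; split; first exact: smooth_translate.
by exists (r + `|h|); exact: supported_in_translate.
Qed.

Lemma test_fun0 : test_fun (fun=> 0).
Proof. by split; [exact: smooth_const | exists 0]. Qed.

Lemma test_fun_sum (I : Type) (r : seq I) (P : pred I) (F : I -> pt -> R) :
  (forall i, test_fun (F i)) -> test_fun (fun x => \sum_(i <- r | P i) F i x).
Proof.
move=> FP; elim: r => [|i r IH].
  by rewrite (_ : (fun x => _) = fun=> 0); [exact: test_fun0 | apply/funext => x; rewrite big_nil].
have := test_fun_add _ _ (FP i) IH; case Pi : (P i) => H.
  by move: H; congr test_fun; apply/funext => x; rewrite big_cons Pi.
by move: IH; congr test_fun; apply/funext => x; rewrite big_cons Pi.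
Qed.

(** Sequential convergence to 0 in D(R^d), as in the continuity clause of [distribution_Rd]. *)
Definition tends_to_zero (u : nat -> pt -> R) : Prop :=
  [/\ forall n, test_fun (u n),
      exists r : R, forall n, supported_in r (u n)
    & forall s e, 0 < e -> \forall n \near \oo, forall x, `|pder s (u n) x| < e].

Lemma tends_to_zero_derive u k : tends_to_zero u -> tends_to_zero (fun n => 'D_(e_ k) (u n)).
Proof.
move=> [ut [r ur] u0]; split.
- move=> n; have [su _] := ut n; split; first exact: smooth_derive.
  by exists r; exact: supported_in_derive.
- by exists r => n; exact: supported_in_derive.
- move=> s e e0; apply: filterS (u0 (rcons s k) e e0) => n un x.
  by rewrite -pder_rcons.
Qed.

(* Leibniz's rule, one derivative at a time. *)
Lemma tends_to_zero_mul g u : smooth g -> tends_to_zero u ->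
  tends_to_zero (fun n x => g x * u n x).
Proof.
move=> sg u0; split.
- by move=> n; case: u0 => ut _ _; exact: test_fun_mul.
- by case: u0 => _ [r ur] _; exists r => n x /ur ->; rewrite mulr0.
move=> s; elim/last_ind: s g u sg u0 => [|s k IH] g u sg u0 e e0.
  case: u0 => ut [r ur] u0.
  have [M M0 gM] := continuous_bounded_on R d _ r (smooth_continuous _ _ _ sg).
  have eM : 0 < e / M by rewrite divr_gt0.
  apply: filterS (u0 [::] _ eM) => n un x /=.
  have [xr|xr] := leP `|x| r; last by rewrite ur // mulr0 normr0.
  rewrite normrM; apply: (@le_lt_trans _ _ (M * `|u n x|)); first by rewrite ler_wpM2r // gM.
  by rewrite -ltr_pdivlMl // mulrC; exact: un.
have su n : smooth (u n) by case: u0 => /(_ n)[].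
have e2 : 0 < e / 2 by rewrite divr_gt0.
have h1 := IH _ _ (smooth_derive _ _ _ k sg) u0 _ e2.
have h2 := IH _ _ sg (tends_to_zero_derive _ k u0) _ e2.
apply: filterS2 h1 h2 => n h1 h2 x.
have -> : pder (rcons s k) (fun y => g y * u n y) =
    pder s (fun y => g y * 'D_(e_ k) (u n) y + 'D_(e_ k) g y * u n y).
  rewrite pder_rcons; congr pder; apply: derive_fun => y.
  rewrite [X in _ + X]mulrC.
  exact: (is_deriveM (smooth_is_derive _ _ _ y k sg) (smooth_is_derive _ _ _ y k (su n))).
rewrite (pder_add _ _ _ _ _ (smooth_mul _ _ _ _ sg (smooth_derive _ _ _ k (su n)))
  (smooth_mul _ _ _ _ (smooth_derive _ _ _ k sg) (su n))).
apply: le_lt_trans (ler_normD _ _) _.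
by have := h1 x; have := h2 x; lra.
Qed.

Lemma tends_to_zero_translate phi (h : nat -> pt) (M : R) : test_fun phi ->
  (forall e : R, 0 < e -> \forall n \near \oo, `|h n| < e) ->
  (forall n, `|h n| <= M) ->
  tends_to_zero (fun n x => phi (x + h n) - phi x).
Proof.
move=> tp h0 h1; have [sp [r pr]] := tp.
have E n : (fun x => phi (x + h n) - phi x) = (fun x => phi (x + h n) + -1 * phi x).
  by apply/funext => x; rewrite mulN1r.
split.
- move=> n; rewrite E; apply: test_fun_add; first exact: test_fun_translate.
  exact: test_fun_scale.
- exists (r + M) => n x xr; have hn := h1 n; have := normr_ge0 (h n) => h2.
  rewrite (supported_in_translate _ _ _ _ (h n) pr) ?sub0r ?pr ?oppr0 //; lra.
move=> s e e0.
have [sc] := (smooth_continuous _ _ _ (smooth_pder _ _ s _ sp), supported_in_pder _ _ _ s _ pr).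
move=> /(compactly_supported_unif_continuous _ _ _ _ sc) /(_ e e0) [del del0 dP].
apply: filterS (h0 del del0) => n hn x.
rewrite E (pder_add _ _ _ _ _ (smooth_translate _ _ _ (h n) sp) (smooth_scale _ _ (-1) _ sp)).
by rewrite (pder_translate _ _ _ _ _ sp) (pder_scale _ _ _ _ _ sp) mulN1r; exact: dP.
Qed.

Lemma interval_average_bound g r k x (a e : R) : continuous g -> supported_in r g -> 0 < a ->
  (forall s : R, 0 <= s <= a -> `|g (x + s *: e_ k) - g x| <= e) ->
  `|a^-1 * line_integral `]0, a] k g x - g x| <= e.
Proof.
move=> gc gr a0 ge.
pose mu : {measure set (measurableTypeR R) -> \bar R} := @lebesgue_measure R.
have mD : measurable (`]0, a]%classic : set (measurableTypeR R)) by exact: measurable_itv.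
have muD : mu `]0, a]%classic = a%:E.
  have -> := (lebesgue_measure_itv `]0, a] : mu `]0, a]%classic = _).
  by rewrite /= lte_fin a0 oppr0 adde0.
have ic (c : R) : mu.-integrable (`]0, a]%classic : set (measurableTypeR R)) (EFin \o (fun=> c)).
  apply/integrableP; split; first exact: measurable_cst.
  by rewrite /= integral_cst // muD -EFinM ltry.
have ig := slice_integrable R d g r k x _ mD gc gr.
have cst c : Rintegral mu `]0, a]%classic (fun=> c) = c * a.
  by rewrite Rintegral_cst // muD.
have inD (s : R) : `]0, a]%classic s -> 0 <= s <= a.
  by rewrite /= in_itv /= => /andP[/ltW -> ->].
have up : line_integral `]0, a] k g x <= (g x + e) * a.
  rewrite -cst; apply: le_Rintegral => // s /inD /ge.
  by rewrite ler_norml => /andP[]; lra.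
have low : (g x - e) * a <= line_integral `]0, a] k g x.
  rewrite -cst; apply: le_Rintegral => // s /inD /ge.
  by rewrite ler_norml => /andP[]; lra.
rewrite ler_norml lerBrDr lerBlDr mulrC ler_pdivlMr // ler_pdivrMr //.
by apply/andP; split; [move: low | move: up]; rewrite ?[- e + _]addrC ?[e + _]addrC.
Qed.

Lemma supported_in_line_integral_interval g r k (a : R) : 0 <= a <= 1 -> supported_in r g ->
  supported_in (r + 1) (line_integral `]0, a] k g).
Proof.
move=> a01 gr x xr; rewrite /line_integral.
have gx (s : R) : `]0, a]%classic s -> g (x + s *: e_ k) = 0.
  rewrite /= in_itv /= => /andP[s0 sa]; apply: gr.
  have := norm_basis_le R d s k; have := ler_normB (x + s *: e_ k) (s *: e_ k).
  by rewrite addrK (gtr0_norm s0); lra.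
under eq_Rintegral => s sD do (rewrite gx; last by move: sD; rewrite inE).
by rewrite Rintegral_cst ?mul0r //; exact: measurable_itv.
Qed.

(** Partial derivatives pass under the integral, so each derivative of the average is the average of
    a uniformly continuous function over an interval shrinking to a point. *)
Lemma tends_to_zero_average phi k : test_fun phi ->
  tends_to_zero (fun n x => n.+1%:R * line_integral `]0, n.+1%:R^-1] k phi x - phi x).
Proof.
move=> tp; have [sp [r pr]] := tp.
have n1 n : 0 <= (n.+1%:R^-1 : R) <= 1.
  by rewrite invr_ge0 ler0n /= invf_le1 ?ler1n ?ltr0n.
have mD n : measurable (`]0, n.+1%:R^-1]%classic : set (measurableTypeR R)) by exact: measurable_itv.
have sl n : smooth (line_integral `]0, n.+1%:R^-1] k phi).
  exact: (smooth_line_integral _ _ _ r).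
have E n : (fun x => n.+1%:R * line_integral `]0, n.+1%:R^-1] k phi x - phi x) =
    (fun x => n.+1%:R * line_integral `]0, n.+1%:R^-1] k phi x + -1 * phi x).
  by apply/funext => x; rewrite mulN1r.
have r1 n := supported_in_line_integral_interval _ _ k _ (n1 n) pr.
split.
- move=> n; rewrite E; apply: test_fun_add; last exact: test_fun_scale.
  by apply: test_fun_scale; split; [exact: sl | exists (r + 1); exact: r1].
- by exists (r + 1) => n x xr; rewrite r1 // pr ?mulr0 ?subrr //; lra.
move=> s e e0; have e2 : 0 < e / 2 by rewrite divr_gt0.
have [sc pr'] := (smooth_continuous _ _ _ (smooth_pder _ _ s _ sp), supported_in_pder _ _ _ s _ pr).
have [del del0 dP] := compactly_supported_unif_continuous _ _ _ _ sc pr' _ e2.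
have : \forall n \near \oo, n.+1%:R^-1 < del.
  exact: near_infty_natSinv_lt (PosNum del0).
apply: filterS => n hn x; rewrite E (pder_add _ _ _ _ _ (smooth_scale _ _ _ _ (sl n)) (smooth_scale _ _ _ _ sp)).
rewrite (pder_scale _ _ _ _ _ (sl n)) (pder_scale _ _ _ _ _ sp) mulN1r (pder_line_integral _ _ _ _ r) //.
apply: (@le_lt_trans _ _ (e / 2)); last by lra.
rewrite -{1}[n.+1%:R]invrK; apply: (interval_average_bound _ r) => //.
move=> t /andP[t0 tn]; apply/ltW/dP; apply: le_lt_trans (norm_basis_le _ _ _ _) _.
by rewrite ger0_norm //; exact: le_lt_trans tn hn.
Qed.

End TestFunctions.

(** * Translation-invariant functionals *)

Section InvariantFunctionals.
Variables (R : realType) (d : nat).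
Local Notation pt := (pt R d).
Local Notation e_ k := (basis_Rd R k : pt).
Implicit Types (x y h : pt) (g f phi psi : pt -> R) (k j : 'I_d) (D : set (measurableTypeR R)).
Local Notation supported_in := (supported_in R d).
Local Notation smooth := (@smooth_Rd R d).
Local Notation test_fun := (@test_fun_Rd R d).
Local Notation line_integral := (line_integral R d).

Definition invariant_functional (S : (pt -> R) -> R) : Prop :=
  [/\ forall (a : R) phi psi, test_fun phi -> test_fun psi ->
        S (fun x => a * phi x + psi x) = a * S phi + S psi,
      forall u, tends_to_zero R d u -> S (u n) @[n --> \oo] --> 0
    & forall h phi, test_fun phi -> S (fun x => phi (x + h)) = S phi].

Lemma test_fun_supported phi : test_fun phi -> exists2 r : R, 0 <= r & supported_in r phi.
Proof.
move=> [_ [r pr]]; exists `|r| => //.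
by apply: supported_inW pr; exact: ler_norm.
Qed.

Lemma test_fun_continuous phi : test_fun phi -> continuous phi.
Proof. by move=> [/smooth_continuous]. Qed.

Lemma norm_gt_coord (r : R) x : 0 <= r -> r < `|x| -> exists j, r < `|x 0 j|.
Proof.
move=> r0 rx; apply: contrapT => /forallNP H; move: rx; rewrite ltNge => /negP; apply.
by apply: norm_rV_le => // j; rewrite leNgt; exact/negP.
Qed.

Lemma add_basis_coord x (s : R) k j : (x + s *: e_ k) 0 j = x 0 j + s * (k == j)%:R.
Proof. by rewrite mxE [X in _ + X]mxE basis_coord. Qed.

Lemma line_integral_invariant phi k x (t : R) : test_fun phi ->
  line_integral setT k phi (x + t *: e_ k) = line_integral setT k phi x.
Proof.
move=> tp; have [r r0 pr] := test_fun_supported phi tp.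
rewrite -[RHS](Rintegral_shift R _ setT (- (r + `|x|)) (r + `|x|) t) //.
- by apply: eq_Rintegral => s _; rewrite -addrA -scalerDl [s + t]addrC.
- exact/continuous_slice/test_fun_continuous.
- exact: slice_support pr _.
Qed.

Lemma line_integral_halfline_increment phi k x (a : R) : test_fun phi -> 0 < a ->
  line_integral `]-oo, 0] k phi (x + a *: e_ k) =
  line_integral `]-oo, 0] k phi x + line_integral `]0, a] k phi x.
Proof.
move=> tp a0; have [r r0 pr] := test_fun_supported phi tp.
have pc := test_fun_continuous _ tp.
have mI (i : interval R) : measurable ([set` i] : set (measurableTypeR R)) by exact: measurable_itv.
transitivity (line_integral `]-oo, a] k phi x).
  rewrite -[RHS](Rintegral_shift R _ _ (- (r + `|x|)) (r + `|x|) a) //.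
  - rewrite (_ : [set s : R | _] = `]-oo, 0]%classic).
      by apply: eq_Rintegral => s _; rewrite -addrA -scalerDl [s + a]addrC.
    by apply/seteqP; split=> s /=; rewrite !in_itv /=; lra.
  - exact: continuous_slice.
  - exact: slice_support pr _.
have E : `]-oo, a]%classic = (`]-oo, 0] `|` `]0, a])%classic :> set R.
  apply/seteqP; split=> s /=; rewrite !in_itv /=.
    by case: (leP s 0); [left | right].
  by case=> [|/andP[]//]; move=> s0; lra.
rewrite /line_integral E Rintegral_setU //.
  by apply: (slice_integrable _ _ _ r) => //; exact: measurableU.
apply/disj_setPS => s [] /=; rewrite !in_itv /= => s0 /andP[s1 _].
by move: (lt_le_trans s1 s0); rewrite ltxx.
Qed.

(** Only compact support is at stake. If a coordinate other than k exceeds r in absolute value, the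
    whole line misses the support; if it is x_k < -r, the half-line does; if x_k > r, the half-line
    integral is the full one, zero by hypothesis. *)
Lemma test_fun_halfline_integral phi k : test_fun phi ->
  (forall x, line_integral setT k phi x = 0) -> test_fun (line_integral `]-oo, 0] k phi).
Proof.
move=> tp p0; have [r r0 pr] := test_fun_supported phi tp.
have mI : measurable (`]-oo, 0]%classic : set (measurableTypeR R)) by exact: measurable_itv.
split; first by apply: (smooth_line_integral _ _ _ r) => //; case: tp.
exists r => x /(norm_gt_coord _ _ r0)[j xj].
have z0 D : measurable D -> (forall s : R, D s -> phi (x + s *: e_ k) = 0) -> line_integral D k phi x = 0.
  move=> mD Dz; rewrite /line_integral.
  under eq_Rintegral => s sD do (rewrite Dz; last by move: sD; rewrite inE).
  by rewrite Rintegral_cst ?mul0r.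
have far (s : R) : r < `|(x + s *: e_ k) 0 j| -> phi (x + s *: e_ k) = 0.
  by move=> rs; apply: pr; apply: lt_le_trans (norm_coord_le _ _ _ j).
have [kj|kj] := eqVneq k j; last first.
  apply: z0 => // s _; apply: far.
  by rewrite add_basis_coord (negbTE kj) mulr0 addr0.
have [xj0|xj0] := leP (x 0 j) 0.
  apply: z0 => // s; rewrite /= in_itv /= => s0; apply: far.
  rewrite add_basis_coord kj eqxx mulr1.
  by move: xj; rewrite !ler0_norm //; lra.
transitivity (line_integral setT k phi x); last exact: p0.
rewrite /line_integral -(setUv (`]-oo, 0]%classic : set (measurableTypeR R))).
rewrite Rintegral_setU //; last 3 first.
- exact: measurableC.
- by rewrite setUv; apply: (slice_integrable _ _ _ r) => //; exact: test_fun_continuous.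
- by apply/disj_setPS => s [].
rewrite -[LHS]addr0; congr (_ + _); symmetry; apply: z0; first exact: measurableC.
move=> s /= /negP; rewrite in_itv /= -ltNge => s0; apply: far.
rewrite add_basis_coord kj eqxx mulr1.
by move: xj; rewrite !gtr0_norm //; lra.
Qed.

Section Functional.
Variable S : (pt -> R) -> R.
Hypothesis invS : invariant_functional S.

Lemma functional0 : S (fun=> 0) = 0.
Proof.
have [Sl _ _] := invS; have := Sl (-1) _ _ (test_fun0 R d) (test_fun0 R d).
rewrite (_ : (fun x => _) = (fun=> 0)) => [H|]; first lra.
by apply/funext => x; rewrite mulr0 addr0.
Qed.

Lemma functionalZ (a : R) phi : test_fun phi -> S (fun x => a * phi x) = a * S phi.
Proof.
have [Sl _ _] := invS; move=> tp; have := Sl a _ _ tp (test_fun0 R d).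
by rewrite functional0 addr0 => <-; congr S; apply/funext => x; rewrite addr0.
Qed.

Lemma functionalB phi psi : test_fun phi -> test_fun psi ->
  S (fun x => phi x - psi x) = S phi - S psi.
Proof.
have [Sl _ _] := invS; move=> tp tq; have := Sl (-1) _ _ tq tp.
by rewrite mulN1r addrC => <-; congr S; apply/funext => x; rewrite mulN1r addrC.
Qed.

(* [phi] is the limit of the difference quotients of its primitive along [e_ k]. *)
Lemma functional_zero_mean phi k : test_fun phi ->
  (forall x, line_integral setT k phi x = 0) -> S phi = 0.
Proof.
move=> tp p0; have [_ Sc Si] := invS.
set Psi := line_integral `]-oo, 0] k phi.
have tP : test_fun Psi := test_fun_halfline_integral phi k tp p0.
have H := Sc _ (tends_to_zero_average R d phi k tp).
(* Invariance makes [S] vanish on difference quotients, so this sequence is constantly [- S phi],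
   while it tends to 0. *)
suff E n : S (fun x => n.+1%:R * line_integral `]0, n.+1%:R^-1] k phi x - phi x) = - S phi.
  have {}H : (fun _ : nat => - S phi) @ \oo --> 0.
    by rewrite (_ : (fun _ : nat => - S phi) = fun n => S (fun x =>
      n.+1%:R * line_integral `]0, n.+1%:R^-1] k phi x - phi x)) //; apply/funext => n; rewrite E.
  have := cvg_lim (@Rhausdorff R) H; rewrite (cvg_lim (@Rhausdorff R) (cvg_cst _)) => h.
  by rewrite -[S phi]opprK h oppr0.
have n0 : 0 < (n.+1%:R^-1 : R) by rewrite invr_gt0 ltr0n.
pose h := n.+1%:R^-1 *: e_ k.
have tPh := test_fun_translate _ _ _ h tP.
have -> : (fun x => n.+1%:R * line_integral `]0, n.+1%:R^-1] k phi x - phi x) =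
    (fun x => n.+1%:R * (Psi (x + h) - Psi x) - phi x).
  apply/funext => x; rewrite /Psi line_integral_halfline_increment //.
  by rewrite [X in _ = _ * X - _]addrAC subrr add0r.
have tPB : test_fun (fun x => Psi (x + h) - Psi x).
  have := test_fun_add _ _ _ _ tPh (test_fun_scale _ _ (-1) _ tP).
  by congr test_fun; apply/funext => x; rewrite mulN1r.
rewrite functionalB //; last exact: test_fun_scale.
by rewrite functionalZ // functionalB // Si // subrr mulr0 sub0r.
Qed.

End Functional.

(** The profile of [chi] along the line through [x0], as a function of coordinate k alone:
    one-variable bumps are extracted from given test functions. *)
Definition bump_at k (chi : pt -> R) (x0 : pt) : pt -> R := fun x => chi (x0 + x 0 k *: e_ k).

Lemma smooth_bump_at k chi x0 : smooth chi -> smooth (bump_at k chi x0).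
Proof.
move=> sc; apply: (smooth_coind _ _ (fun f => f = (fun=> 0) \/
    exists2 g, smooth g & f = bump_at k g x0)); last by right; exists chi.
move=> _ [->|[{sc}chi sc ->]]; (split=> [|j]).
- exact: cst_continuous.
- by exists (fun=> 0); [left | move=> x; exact: is_derive_cst].
- move=> x; apply: (@continuous_comp _ _ _ (fun x : pt => x 0 k) (fun s : R => chi (x0 + s *: e_ k))).
    exact: coord_continuous.
  exact/continuous_slice/smooth_continuous.
have jE x (t : R) : (t *: e_ j + x) 0 k = x 0 k + t * (j == k)%:R.
  by rewrite addrC add_basis_coord.
have [jk|jk] := eqVneq j k; last first.
  exists (fun=> 0); first by left.
  move=> x; apply: is_derive_eps => e e0; exists 1 => // t t0 _.
  rewrite /bump_at jE (negbTE jk) mulr0 addr0 subrr mulr0 subrr normr0.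
  exact: ltW.
exists (bump_at k ('D_(e_ k) chi) x0).
  by right; exact: (ex_intro2 _ _ _ (smooth_derive _ _ _ k sc) erefl).
move=> x; have := smooth_is_derive _ _ chi (x0 + x 0 k *: e_ k) k sc.
have E : (fun t : R => t^-1 *: ((bump_at k chi x0 \o shift x) (t *: e_ j) - bump_at k chi x0 x))
   = (fun t : R => t^-1 *: ((chi \o shift (x0 + x 0 k *: e_ k)) (t *: e_ k) - chi (x0 + x 0 k *: e_ k))).
  apply/funext => t /=; rewrite /bump_at jE jk eqxx mulr1 scalerDl; congr (_ *: (chi _ - _)).
  by rewrite addrA addrC.
by move=> [d1 d2]; apply: DeriveDef; [rewrite /derivable E | rewrite {1}/derive E].
Qed.

Lemma line_integral_bump_at k chi x0 x : test_fun chi ->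
  line_integral setT k (bump_at k chi x0) x = line_integral setT k chi x0.
Proof.
move=> tc; have [r r0 cr] := test_fun_supported chi tc.
rewrite -[RHS](Rintegral_shift R _ setT (- (r + `|x0|)) (r + `|x0|) (x 0 k)) //.
- apply: eq_Rintegral => s _; rewrite /bump_at add_basis_coord eqxx mulr1.
  by rewrite [s + _]addrC.
- exact/continuous_slice/test_fun_continuous.
- exact: slice_support cr _.
Qed.

Lemma bump_at_support k chi x0 (r : R) x : supported_in r chi -> r + `|x0| < `|x 0 k| ->
  bump_at k chi x0 x = 0.
Proof.
move=> cr xr; apply: (slice_support _ _ _ r _ _ (r + `|x0|)) => //.
by rewrite -ler_norml leNgt xr.
Qed.

(** The line integral no longer depends on coordinate k; the factor [X] restores compact support in
    that direction. *)
Definition integrate_out k (X phi : pt -> R) : pt -> R := fun x => X x * line_integral setT k phi x.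

Lemma test_fun_integrate_out k chi x0 phi : test_fun chi -> test_fun phi ->
  test_fun (integrate_out k (bump_at k chi x0) phi).
Proof.
move=> tc tp; have [r r0 cr] := test_fun_supported chi tc.
have [r' r'0 pr] := test_fun_supported phi tp.
split.
  apply: smooth_mul; first by apply: smooth_bump_at; case: tc.
  by apply: (smooth_line_integral _ _ _ r') => //; case: tp.
exists (r + `|x0| + r') => x.
have M0 : 0 <= r + `|x0| + r' by rewrite !addr_ge0.
move=> /(norm_gt_coord _ _ M0)[j xj]; rewrite /integrate_out.
have := normr_ge0 x0 => x00.
have [kj|kj] := eqVneq k j; first by rewrite (bump_at_support _ _ _ r) ?mul0r // kj; lra.
rewrite /line_integral; under eq_Rintegral => s _.
  rewrite pr; last first.
    apply: lt_le_trans (norm_coord_le _ _ _ j).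
    by rewrite add_basis_coord (negbTE kj) mulr0 addr0; lra.
  over.
by rewrite Rintegral_cst // mul0r mulr0.
Qed.

(** The bump has integral 1, so both functions have the same integral along every line parallel to
    [e_ k], and [functional_zero_mean] applies to their difference. *)
Lemma functional_integrate_out S k chi x0 phi : invariant_functional S -> test_fun chi ->
  line_integral setT k chi x0 = 1 -> test_fun phi ->
  S (integrate_out k (bump_at k chi x0) phi) = S phi.
Proof.
move=> iS tc c1 tp; have tf := test_fun_integrate_out k chi x0 phi tc tp.
apply/esym/subr0_eq; rewrite -functionalB //.
apply: (functional_zero_mean _ iS _ k).
  have := test_fun_add _ _ _ _ tp (test_fun_scale _ _ (-1) _ tf).
  by congr test_fun; apply/funext => x; rewrite mulN1r.
move=> x; have [r r0 pr] := test_fun_supported phi tp.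
have [r' r'0 fr] := test_fun_supported _ tf.
rewrite /line_integral RintegralB //; last 2 first.
- by apply: (slice_integrable _ _ _ r) => //; exact: test_fun_continuous.
- by apply: (slice_integrable _ _ _ r') => //; exact: test_fun_continuous.
rewrite -/(line_integral setT k phi x) /integrate_out.
under [X in _ - X]eq_Rintegral => s _ do rewrite line_integral_invariant //.
have [rc rc0 cr] := test_fun_supported chi tc.
rewrite RintegralZr //; last first.
  rewrite (_ : (fun s : R => _) = (fun s : R => chi (x0 + x 0 k *: e_ k + s *: e_ k))).
    by apply: (slice_integrable _ _ _ rc) => //; exact: test_fun_continuous.
  by apply/funext => s; rewrite /bump_at add_basis_coord eqxx mulr1 scalerDl addrA.
rewrite -/(line_integral setT k (bump_at k chi x0) x) line_integral_bump_at // c1.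
by rewrite mul1r subrr.
Qed.

End InvariantFunctionals.

(** * Invariant functionals and the iterated integral *)

Section IteratedIntegral.
Variables (R : realType) (d : nat).
Local Notation pt := (pt R d).
Local Notation e_ k := (basis_Rd R k : pt).
Implicit Types (x y h : pt) (g f phi psi : pt -> R) (k j : 'I_d).
Local Notation supported_in := (supported_in R d).
Local Notation smooth := (@smooth_Rd R d).
Local Notation test_fun := (@test_fun_Rd R d).
Local Notation line_integral := (line_integral R d).
Local Notation invariant_functional := (invariant_functional R d).

Lemma Rintegral_setcoord phi k x : test_fun phi ->
  Rintegral (@lebesgue_measure R) setT (fun t => phi (setcoord_Rd x k t)) =
  line_integral setT k phi x.
Proof.
move=> tp; have [r r0 pr] := test_fun_supported R d phi tp.
rewrite -[RHS](Rintegral_shift R _ setT (- (r + `|x|)) (r + `|x|) (- x 0 k)) //.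
- apply: eq_Rintegral => t _; congr phi; apply/rowP => j.
  rewrite mxE add_basis_coord -val_eqE /= eq_sym.
  case: eqP => [/val_inj <-|_]; rewrite ?mulr1 ?mulr0 ?addr0 //; ring.
- exact/continuous_slice/test_fun_continuous.
- exact: slice_support pr _.
Qed.

Lemma iint_ext n g x y : (forall j, (n <= j)%N -> x 0 j = y 0 j) ->
  iint_Rd n g x = iint_Rd n g y.
Proof.
elim: n x y => [|n IH] x y xy /=; first by congr g; apply/rowP => j; exact: xy.
apply: eq_Rintegral => t _; apply: IH => j nj; rewrite !mxE.
by case: eqP => // /eqP jn; apply: xy; rewrite ltn_neqAle eq_sym jn.
Qed.

Section Bumps.
Variables (chi : 'I_d -> pt -> R) (x0 : 'I_d -> pt).
Hypothesis tchi : forall k, test_fun (chi k).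
Hypothesis chi1 : forall k, line_integral setT k (chi k) (x0 k) = 1.
Let X k := bump_at R d k (chi k) (x0 k).

(** Coordinates go in the order of [iint_Rd]; [insub] fails only for indices beyond the
    dimension. *)
Fixpoint integrate_out_upto (n : nat) phi : pt -> R :=
  if n is n'.+1 then
    if insub n' is Some k then integrate_out R d k (X k) (integrate_out_upto n' phi)
    else integrate_out_upto n' phi
  else phi.

Lemma test_fun_integrate_out_upto n phi : test_fun phi -> test_fun (integrate_out_upto n phi).
Proof.
move=> tp; elim: n => [//|n IH] /=.
by case: insubP => [k _ _|_]; [exact: test_fun_integrate_out | exact: IH].
Qed.

Lemma functional_integrate_out_upto S n phi : invariant_functional S -> test_fun phi ->
  S (integrate_out_upto n phi) = S phi.
Proof.
move=> iS tp; elim: n => [//|n IH] /=.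
case: insubP => [k _ _|_]; last exact: IH.
by rewrite functional_integrate_out //; exact: test_fun_integrate_out_upto.
Qed.

Lemma integrate_out_upto_linear n (a : R) phi psi x : test_fun phi -> test_fun psi ->
  integrate_out_upto n (fun x => a * phi x + psi x) x =
  a * integrate_out_upto n phi x + integrate_out_upto n psi x.
Proof.
move=> tp tq; elim: n x => [//|n IH] x /=; case: insubP => [k _ _|_]; last exact: IH.
have tp' := test_fun_integrate_out_upto n _ tp; have tq' := test_fun_integrate_out_upto n _ tq.
have tap := test_fun_scale R d a _ tp'.
have [r r0 pr] := test_fun_supported R d _ tp'; have [r' r'0 qr] := test_fun_supported R d _ tq'.
have pr' : supported_in (r + r') (integrate_out_upto n phi) by apply: supported_inW pr; lra.
have qr' : supported_in (r + r') (integrate_out_upto n psi) by apply: supported_inW qr; lra.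
have apr : supported_in (r + r') (fun x => a * integrate_out_upto n phi x).
  by move=> z /pr' ->; rewrite mulr0.
rewrite /integrate_out (_ : integrate_out_upto n _ =
  fun x => a * integrate_out_upto n phi x + integrate_out_upto n psi x); last by apply/funext.
rewrite (line_integralD _ _ _ _ (r + r')) //; [|exact: test_fun_continuous|exact: test_fun_continuous].
rewrite (line_integralZ _ _ _ (r + r')) //; last exact: test_fun_continuous.
by ring.
Qed.

Lemma integrate_out_upto_iint n phi x : test_fun phi -> (n <= d)%N ->
  integrate_out_upto n phi x = (\prod_(i < d | (i < n)%N) X i x) * iint_Rd n phi x.
Proof.
move=> tp; elim: n x => [|n IH] x nd; first by rewrite big_pred0 // mul1r.
rewrite /= insubT /integrate_out; set k := Sub n nd : 'I_d.
rewrite (bigD1 k) //= -mulrA; congr (_ * _).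
rewrite -Rintegral_setcoord; last exact: test_fun_integrate_out_upto.
pose c := \prod_(i < d | (i < n)%N) X i x.
have cE t : integrate_out_upto n phi (setcoord_Rd x n t) = c * iint_Rd n phi (setcoord_Rd x n t).
  rewrite IH 1?ltnW //; congr (_ * _); apply: eq_bigr => i ik.
  by rewrite /X /bump_at mxE (ltn_eqF ik).
under eq_Rintegral => t _ do rewrite cE.
have -> : \prod_(i < d | (i < n.+1)%N && (i != k)) X i x = c.
  by apply: eq_bigl => i; rewrite -val_eqE /= ltnS andbC -ltn_neqAle.
(* Integrability of the slice of [iint_Rd n phi] is obtained from that of [integrate_out_upto n phi]
   on dividing by [c]. *)
have [c0|c0] := eqVneq c 0.
  under eq_Rintegral => t _ do rewrite c0 mul0r.
  by rewrite c0 mul0r Rintegral_cst // mul0r.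
rewrite RintegralZl //.
have [r r0 pr] := test_fun_supported R d _ (test_fun_integrate_out_upto n _ tp).
have ig : (@lebesgue_measure R).-integrable setT
    (EFin \o (fun t => integrate_out_upto n phi (x + (- x 0 k) *: e_ k + t *: e_ k))).
  apply: (slice_integrable _ _ _ r) => //.
  exact/test_fun_continuous/test_fun_integrate_out_upto.
have := integrableZl measurableT c^-1 ig.
congr (_.-integrable _ _); apply/funext => t /=; rewrite -EFinM; congr EFin.
have -> : x + - x 0 k *: e_ k + t *: e_ k = setcoord_Rd x n t.
  apply/rowP => j; rewrite add_basis_coord add_basis_coord [RHS]mxE -val_eqE /= eq_sym.
  case: eqP => [jn|_]; rewrite ?mulr1 ?mulr0 ?addr0 //.
  have -> : j = k by apply: val_inj.
  by ring.
by rewrite cE mulKf.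
Qed.

Let Y x := \prod_(i < d) X i x.

Lemma integrate_out_all phi x : test_fun phi -> integrate_out_upto d phi x = integral_Rd phi * Y x.
Proof.
move=> tp; rewrite integrate_out_upto_iint // mulrC; congr (_ * _).
  by apply: iint_ext => j; rewrite leqNgt ltn_ord.
by apply: eq_bigl => i; rewrite ltn_ord.
Qed.

Lemma test_fun_prod_bump : test_fun Y.
Proof.
split; first by apply: smooth_prod => i; apply: smooth_bump_at; case: (tchi i).
have /choice[r rP] : forall i, exists r : R, 0 <= r /\ supported_in r (chi i).
  by move=> i; have [r r0 cr] := test_fun_supported R d _ (tchi i); exists r.
pose M := \sum_i (r i + `|x0 i|).
have Mi i : r i + `|x0 i| <= M.
  rewrite /M (bigD1 i) //= lerDl sumr_ge0 // => j _.
  by rewrite addr_ge0 //; case: (rP j).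
have M0 : 0 <= M by rewrite sumr_ge0 // => j _; rewrite addr_ge0 //; case: (rP j).
exists M => x /(norm_gt_coord _ _ _ _ M0)[j xj].
rewrite /Y (bigD1 j) //= /X (bump_at_support _ _ _ _ _ (r j)) ?mul0r //; first by case: (rP j).
exact: le_lt_trans (Mi j) xj.
Qed.

(** Integrating out all coordinates turns [phi] into [integral_Rd phi] times the fixed function [Y],
    and [S] takes the same value on both. *)
Lemma invariant_functional_integral S phi : invariant_functional S -> test_fun phi ->
  S phi = S Y * integral_Rd phi.
Proof.
move=> iS tp; rewrite -(functional_integrate_out_upto S d) // mulrC.
rewrite (_ : integrate_out_upto d phi = fun x => integral_Rd phi * Y x).
  by rewrite functionalZ //; exact: test_fun_prod_bump.
by apply/funext => x; exact: integrate_out_all.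
Qed.

(** Each bump has integral 1, so it is nonzero somewhere; as the i-th one sees only coordinate i,
    these choices combine into one point. *)
Lemma prod_bump_neq0 : exists y, Y y != 0.
Proof.
have /choice[z zP] : forall i, exists z, X i z != 0.
  move=> i; apply: contrapT => /forallNP H.
  have := line_integral_bump_at R d i (chi i) (x0 i) 0 (tchi i).
  rewrite chi1 /line_integral; under eq_Rintegral => s _.
    rewrite (_ : bump_at _ _ _ _ _ _ = 0); last by apply: contrapT => h; apply: (H (0 + s *: e_ i)); apply/eqP.
    over.
  by rewrite Rintegral_cst // mul0r => h; have := @oner_neq0 R; rewrite -h eqxx.
exists (\row_i z i 0 i); apply/prodf_neq0 => i _.
by rewrite /X /bump_at mxE; exact: zP.
Qed.

(** Linearity is inherited from [integrate_out_upto] at a point where [Y] is nonzero; integrability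
    of the inner iterated integrals is thereby bypassed. *)
Lemma integral_linear (a : R) phi psi : test_fun phi -> test_fun psi ->
  integral_Rd (fun x => a * phi x + psi x) = a * integral_Rd phi + integral_Rd psi.
Proof.
move=> tp tq; have [y y0] := prod_bump_neq0.
have t := test_fun_add R d _ _ (test_fun_scale R d a _ tp) tq.
apply: (mulIf y0); rewrite -integrate_out_all // integrate_out_upto_linear // !integrate_out_all //.
by ring.
Qed.

End Bumps.

Lemma integral0 : integral_Rd (fun _ : pt => 0 : R) = 0.
Proof.
suff H n x : iint_Rd n (fun _ : pt => 0 : R) x = 0 by exact: H.
elim: n x => [//|n IH] x /=.
under eq_Rintegral => t _ do rewrite IH.
by rewrite Rintegral_cst // mul0r.
Qed.

(* The first alternative never occurs; allowing for it avoids the construction of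
   a smooth bump function. *)
Lemma invariant_functional_classification :
  (forall S phi, invariant_functional S -> test_fun phi -> S phi = 0) \/
  (exists Y, (forall S phi, invariant_functional S -> test_fun phi ->
                S phi = S Y * integral_Rd phi) /\
     (forall (a : R) phi psi, test_fun phi -> test_fun psi ->
        integral_Rd (fun x => a * phi x + psi x) = a * integral_Rd phi + integral_Rd psi)).
Proof.
have [H|/existsNP[k Hk]] := pselect (forall k, exists chi x0, test_fun chi /\ line_integral setT k chi x0 != 0).
  right.
  have /choice[c cP] : forall k, exists c : (pt -> R) * pt, test_fun c.1 /\ line_integral setT k c.1 c.2 = 1.
    move=> k; have [chi [x0 [tc c0]]] := H k.
    have [r r0 cr] := test_fun_supported R d _ tc.
    exists ((fun x => (line_integral setT k chi x0)^-1 * chi x), x0); split.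
      exact: test_fun_scale.
    by rewrite /= (line_integralZ _ _ _ r) ?mulVf //; exact: test_fun_continuous.
  have t k := (cP k).1; have c1 k := (cP k).2.
  eexists; split.
    move=> S phi; exact: (invariant_functional_integral (fun k => (c k).1) (fun k => (c k).2) t c1 S phi).
  move=> a phi psi; exact: (integral_linear (fun k => (c k).1) (fun k => (c k).2) t c1).
(* Here every test function has zero integral along all lines parallel to [e_ k]. *)
left=> S phi iS tp; apply: (functional_zero_mean _ _ _ iS phi k tp) => x.
apply: contrapT => h; apply: Hk; exists phi, x; split=> //; exact/eqP.
Qed.

End IteratedIntegral.

(** * Distributions *)

Section Distributions.
Variables (R : realType) (d : nat).
Local Notation pt := (pt R d).
Local Notation e_ k := (basis_Rd R k : pt).
Implicit Types (x y h : pt) (phi psi : pt -> R) (T : (pt -> R) -> R).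
Local Notation test_fun := (@test_fun_Rd R d).
Local Notation distribution := (@distribution_Rd R d).
Local Notation invariant_functional := (invariant_functional R d).

Lemma distribution_tends_to_zero T u : distribution T -> tends_to_zero R d u ->
  T (u n) @[n --> \oo] --> 0.
Proof. by move=> [_ Tc _] [ut [r ur] u0]; apply: Tc => //; exists r. Qed.

Lemma distribution0 T : distribution T -> T (fun=> 0) = 0.
Proof.
move=> [Tl _ _]; have := Tl (-1) _ _ (test_fun0 R d) (test_fun0 R d).
rewrite (_ : (fun x => _) = (fun=> 0)) => [H|]; first lra.
by apply/funext => x; rewrite mulr0 addr0.
Qed.

Lemma distributionZ T (a : R) phi : distribution T -> test_fun phi ->
  T (fun x => a * phi x) = a * T phi.
Proof.
move=> dT tp; have [Tl _ _] := dT; have := Tl a _ _ tp (test_fun0 R d).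
by rewrite distribution0 // addr0 => <-; congr T; apply/funext => x; rewrite addr0.
Qed.

Lemma distribution_sum T n (a : 'I_n -> R) (F : 'I_n -> pt -> R) : distribution T ->
  (forall i, test_fun (F i)) ->
  T (fun x => \sum_i a i * F i x) = \sum_i a i * T (F i).
Proof.
move=> dT tF; have [Tl _ _] := dT.
have aux (r : seq 'I_n) : T (fun x => \sum_(i <- r) a i * F i x) = \sum_(i <- r) a i * T (F i).
  elim: r => [|i r IH].
    rewrite big_nil -[RHS](distribution0 T dT); congr T; apply/funext => x; exact: big_nil.
  rewrite big_cons -IH -Tl //.
    by congr T; apply/funext => x; rewrite big_cons.
  by apply: test_fun_sum => j; exact: test_fun_scale.
exact: aux.
Qed.

(** The continuity clause of a distribution is sequential, so continuity is tested along sequences;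
    boundedness of the sequence gives the translates a common support. *)
Lemma distribution_translate_continuous T phi k : distribution T -> test_fun phi ->
  continuous (fun t : R => T (fun x => phi (x - t *: e_ k))).
Proof.
move=> dT tp t0; have [Tl _ _] := dT.
apply/(@cvg_nbhsP _ R^o) => u ut.
pose psi x := phi (x - t0 *: e_ k).
have tpsi : test_fun psi by exact: test_fun_translate.
have [M M0 uM] : exists2 M : R, 0 < M & forall n, `|u n| <= M.
  have /cvg_seq_bounded/pinfty_ex_gt0[M M0 uM] : cvgn u by apply/cvg_ex; exists t0.
  by exists M => // n; exact: uM.
pose h n := (t0 - u n) *: e_ k.
have H : tends_to_zero R d (fun n x => psi (x + h n) - psi x).
  apply: (tends_to_zero_translate _ _ _ _ (`|t0| + M)) => // [e e0|n].
    move/cvgrPdist_lt : ut => /(_ e e0); apply: filterS => n.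
    by apply: le_lt_trans; exact: norm_basis_le.
  apply: le_trans (norm_basis_le _ _ _ _) _; apply: le_trans (ler_normB _ _) _.
  by rewrite lerD2l.
have {}H := distribution_tends_to_zero T _ dT H.
have E n : T (fun x => phi (x - u n *: e_ k)) = T (fun x => psi (x + h n) - psi x) + T psi.
  have := Tl 1 (fun x => psi (x + h n) - psi x) psi.
  rewrite mul1r => <- //.
    congr T; apply/funext => x; rewrite mul1r subrK /psi; congr phi.
    by rewrite /h scalerBl addrA addrAC addrK.
  have := test_fun_add R d _ _ (test_fun_translate R d _ (h n) tpsi) (test_fun_scale R d (-1) _ tpsi).
  by congr test_fun; apply/funext => x; rewrite mulN1r.
rewrite (_ : (fun n => _) = fun n => T (fun x => psi (x + h n) - psi x) + T psi); last first.
  by apply/funext.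
by rewrite -[X in _ --> X]add0r; apply: cvgD => //; exact: cvg_cst.
Qed.

(** * Untwisting the translation action *)

Section Representation.
Variables (m : nat) (T : 'I_m -> (pt -> R) -> R) (A : pt -> 'M[R]_m).
Hypothesis dT : forall i, distribution (T i).
Hypothesis TA : forall h i phi, T i (fun x => phi (x - h)) = \sum_j A h i j * T j phi.
Hypothesis AD : forall h k, A (h + k) = A h *m A k.
Hypothesis A0 : A 0 = 1%:M.
Hypothesis Ap : forall i j, polynomial_fun R d (fun h => A h i j).

Let AN_smooth i j : smooth_Rd (fun x => A (- x) i j).
Proof.
have [p /funext pE] := Ap i j.
rewrite (_ : (fun x => A (- x) i j) =
  (fun x => \sum_(m <- msupp p) mcoeff m p * \prod_i (- 1 * x 0 i) ^+ m i)).
  apply: smooth_sum => k; apply: smooth_scale; apply: smooth_prod => l; apply: smooth_exp.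
  by apply: smooth_scale; exact: smooth_coord.
apply/funext => x; have := congr1 (fun F => F (- x)) pE; rewrite /= => ->.
rewrite /polyfun_Rd mevalE; apply: eq_bigr => k _; congr (_ * _).
by apply: eq_bigr => l _; rewrite mxE mulN1r.
Qed.

(* Undoing the translation action: [sum_j A (-x) i j * T j] is translation
   invariant. *)
Definition untwist i phi : R := \sum_j T j (fun x => A (- x) i j * phi x).

(** Invariance comes from A(-x) = A(-(x + h)) A(h): moving the shift onto the [T j] contributes
    A(-h), and A(h) A(-h) = 1. *)
Lemma untwist_invariant i : invariant_functional (untwist i).
Proof.
have tm j phi : test_fun phi -> test_fun (fun x => A (- x) i j * phi x).
  by apply: test_fun_mul.
split.
- move=> a phi psi tp tq; rewrite /untwist mulr_sumr -big_split /=; apply: eq_bigr => j _.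
  have [Tl _ _] := dT j; rewrite -Tl; [|exact: tm|exact: tm].
  by congr T; apply/funext => x; ring.
- move=> u u0; rewrite /untwist.
  have H j : T j (fun x => A (- x) i j * u n x) @[n --> \oo] --> 0.
    by apply: distribution_tends_to_zero => //; exact: tends_to_zero_mul.
  have aux (r : seq 'I_m) : \sum_(j <- r) T j (fun x => A (- x) i j * u n x) @[n --> \oo] --> 0.
    elim: r => [|j r IH].
      by rewrite (_ : (fun n => _) = fun=> 0); [exact: cvg_cst | apply/funext => n; rewrite big_nil].
    rewrite (_ : (fun n => _) = fun n => T j (fun x => A (- x) i j * u n x) +
        \sum_(j <- r) T j (fun x => A (- x) i j * u n x)).
      by rewrite -[X in _ --> X]addr0; exact: cvgD.
    by apply/funext => n; rewrite big_cons.
  exact: aux.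
move=> h phi tp; rewrite /untwist.
pose P l := T l (fun x => A (- x) i l * phi x).
have E j : T j (fun x => A (- x) i j * phi (x + h)) =
    \sum_l \sum_k A h k j * A (- h) j l * T l (fun x => A (- x) i k * phi x).
  pose psi y := \sum_k A h k j * (A (- y) i k * phi y).
  have -> : (fun x => A (- x) i j * phi (x + h)) = (fun x => psi (x - - h)).
    apply/funext => x; rewrite opprK /psi.
    have -> : - x = - (x + h) + h by rewrite opprD subrK.
    rewrite AD mxE mulr_suml; apply: eq_bigr => k _.
    by ring.
  rewrite (TA (- h) j psi); apply: eq_bigr => l _; rewrite /psi distribution_sum //; last by move=> k; exact: tm.
  by rewrite mulr_sumr; apply: eq_bigr => k _; ring.
under eq_bigr do rewrite E.
rewrite exchange_big /=; apply: eq_bigr => l _.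
rewrite exchange_big /= (bigD1 l) //= [X in _ + X]big1 ?addr0 => [|k kl]; rewrite -mulr_suml.
  have := congr1 (fun M : 'M[R]_m => M l l) (AD h (- h)); rewrite subrr A0 !mxE eqxx => <-.
  by rewrite mul1r.
have := congr1 (fun M : 'M[R]_m => M k l) (AD h (- h)); rewrite subrr A0 !mxE (negbTE kl) => <-.
by rewrite mul0r.
Qed.

Lemma untwist_inverse i phi : test_fun phi ->
  T i phi = \sum_j untwist j (fun x => A x i j * phi x).
Proof.
move=> tp; rewrite /untwist exchange_big /=.
have tA j k : test_fun (fun x => A (- x) j k * (A x i j * phi x)).
  apply: test_fun_mul => //; apply: test_fun_mul => //.
  exact: smooth_polynomial_fun.
have E k : \sum_j T k (fun x => A (- x) j k * (A x i j * phi x)) = (i == k)%:R * T k phi.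
  rewrite -distributionZ //.
  transitivity (T k (fun x => \sum_j 1 * (A (- x) j k * (A x i j * phi x)))).
    by rewrite distribution_sum //; apply: eq_bigr => j _; rewrite mul1r.
  congr T; apply/funext => x.
  have := congr1 (fun M : 'M[R]_m => M i k) (AD x (- x)); rewrite subrr A0 !mxE => ->.
  by rewrite mulr_suml; apply: eq_bigr => j _; ring.
under eq_bigr do rewrite E.
rewrite (bigD1 i) //= eqxx mul1r big1 ?addr0 // => k ki.
by rewrite eq_sym (negbTE ki) mul0r.
Qed.

Lemma distribution_combination_polynomial (c : 'I_m -> R) :
  exists p : mpoly d R, forall phi, test_fun phi ->
    \sum_i c i * T i phi = integral_Rd (fun x => polyfun_Rd p x * phi x).
Proof.
have tA i j phi : test_fun phi -> test_fun (fun x => A x i j * phi x).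
  by apply: test_fun_mul; exact: smooth_polynomial_fun.
have [H|[Y [H I_lin]]] := invariant_functional_classification R d.
  exists 0 => phi tp; rewrite big1 => [|i _]; last first.
    rewrite untwist_inverse // big1 ?mulr0 // => j _; apply: H; last exact: tA.
    exact: untwist_invariant.
  rewrite -[LHS](integral0 R d); congr integral_Rd; apply/funext => x.
  by rewrite /polyfun_Rd meval0 mul0r.
(* The j-th untwisted functional is [untwist j Y] times the integral; twisting back by [A x]
   produces this density. *)
have [p pE] : polynomial_fun R d (fun x => \sum_i c i * \sum_j untwist j Y * A x i j).
  apply: polynomial_fun_sum => i; apply: polynomial_funM; first exact: polynomial_fun_const.
  apply: polynomial_fun_sum => j; apply: polynomial_funM; first exact: polynomial_fun_const.
  exact: Ap.
exists p => phi tp.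
have I_sum n (a : 'I_n -> R) (F : 'I_n -> pt -> R) : (forall i, test_fun (F i)) ->
    integral_Rd (fun x => \sum_i a i * F i x) = \sum_i a i * integral_Rd (F i).
  move=> tF; have aux (r : seq 'I_n) : integral_Rd (fun x => \sum_(i <- r) a i * F i x) =
      \sum_(i <- r) a i * integral_Rd (F i).
    elim: r => [|i r IH].
      rewrite big_nil -[RHS](integral0 R d); congr integral_Rd; apply/funext => x; exact: big_nil.
    rewrite big_cons -IH -I_lin //.
      by congr integral_Rd; apply/funext => x; rewrite big_cons.
    by apply: test_fun_sum => j; exact: test_fun_scale.
  exact: aux.
have -> : (fun x => polyfun_Rd p x * phi x) =
    (fun x => \sum_i c i * (\sum_j untwist j Y * (A x i j * phi x))).
  apply/funext => x; rewrite -pE mulr_suml; apply: eq_bigr => i _.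
  by rewrite -mulrA mulr_suml; congr (_ * _); apply: eq_bigr => j _; rewrite mulrA.
rewrite I_sum; last first.
  by move=> i; apply: test_fun_sum => j; apply: test_fun_scale; exact: tA.
apply: eq_bigr => i _; congr (_ * _).
rewrite I_sum; last by move=> j; exact: tA.
rewrite untwist_inverse //; apply: eq_bigr => j _.
by rewrite (H _ _ (untwist_invariant j)) //; exact: tA.
Qed.

End Representation.

(** * The case of distributions *)

Lemma distribution_case (special : bool) (V : set ((pt -> R) -> R)) (f : (pt -> R) -> R) :
  (2 <= d)%N ->
  (exists (n : nat) (g : 'I_n -> (pt -> R) -> R), V = span_of_Rd g) ->
  V `<=` @Dd R d ->
  (forall h : pt, forall T, V T -> V (tauD h T)) ->
  (forall P : 'M[R]_d, in_group_Rd special P -> forall T, V T -> V (OD P T)) ->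
  V f ->
  exists p : mpoly d R, forall phi, test_fun phi ->
    f phi = integral_Rd (fun x => polyfun_Rd p x * phi x).
Proof.
move=> d2 [n [g ->]] VD Vtau VO fV.
have invP (P : 'M[R]_d) : P *m P^T = 1%:M -> invmx P = P^T.
  move=> PP; have Pu : P \in unitmx by have [] := mulmx1_unit PP.
  by rewrite -[LHS]mulmx1 -PP mulKmx.
have [||||||F G phi i FV GV G0|m [e [A [eV VE eA [AD A0] Ap]]]] :=
  invariant_span_polynomial R d _ (fun h phi x => phi (x - h))
    (fun P phi x => phi (matact_Rd (invmx P) x)) n g d2.
- by move=> h k phi; apply/funext => x; rewrite opprD addrA.
- by move=> phi; apply/funext => x; rewrite subr0.
- move=> P h phi [PP _]; apply/funext => x; congr phi.
  rewrite invP // /matact_Rd trmxK mulmxBl; congr (_ - _).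
  by rewrite -mulmxA (mulmx1C PP) mulmx1.
- move=> P phi [PP _]; apply/funext => x; congr phi.
  rewrite invP // invP; last by rewrite trmxK; exact: mulmx1C.
  by rewrite /matact_Rd !trmxK -mulmxA (mulmx1C PP) mulmx1.
- by move=> h F /(Vtau h).
- move=> P F [PP P1] /(VO P) H.
  have := H (conj PP (fun=> P1 isT)); congr span_of_Rd; apply/funext => phi.
  by rewrite /OD P1 // normr1 invr1 mul1r.
(* A distribution is zero off test functions, so [G phi != 0] makes [phi] a test function. *)
- have tp : test_fun phi.
    apply: contrapT => ntp; have [_ _ /(_ _ ntp) h] := VD _ GV.
    by rewrite h eqxx in G0.
  exact: distribution_translate_continuous (VD _ FV) tp.
have [c fE] := VE f fV.
have [p pE] := distribution_combination_polynomial m e A (fun i => VD _ (eV i)) eA AD A0 Ap c.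
by exists p => phi tp; rewrite fE pE.
Qed.

End Distributions.

Theorem mainTheorem9 (R : realType) (d : nat) (hd : (2 <= d)%N) (special : bool) :
  (* case X_d = C(R^d) *)
  (forall (V : set (pt R d -> R)) (f : pt R d -> R),
     (exists (n : nat) (g : 'I_n -> pt R d -> R), V = span_of_Rd g) ->
     V `<=` @Cd R d ->
     (forall h : pt R d, forall F, V F -> V (tauC h F)) ->
     (forall P : 'M[R]_d, in_group_Rd special P -> forall F, V F -> V (OC P F)) ->
     V f ->
     exists p : mpoly.mpoly d R, forall x, f x = polyfun_Rd p x) /\
  (* case X_d = D(R^d)' *)
  (forall (V : set ((pt R d -> R) -> R)) (f : (pt R d -> R) -> R),
     (exists (n : nat) (g : 'I_n -> (pt R d -> R) -> R), V = span_of_Rd g) ->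
     V `<=` @Dd R d ->
     (forall h : pt R d, forall T, V T -> V (tauD h T)) ->
     (forall P : 'M[R]_d, in_group_Rd special P -> forall T, V T -> V (OD P T)) ->
     V f ->
     exists p : mpoly.mpoly d R, forall phi, test_fun_Rd phi ->
       f phi = integral_Rd (fun x => (polyfun_Rd p x * phi x)%R)).
Proof.
split=> V f.
- exact: continuous_case.
- exact: distribution_case.
Qed.
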